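(* A metrizable space $X$ has a first countable uniform Eberlein compactification if and only if $|X|\le\mathfrak c$.
   Context: $\mathfrak c$ denotes the cardinality of the continuum. A compact space is uniform Eberlein if it is homeomorphic to a compact subset of a Hilbert space endowed with its weak topology. A compactification of a space $X$ is a compact Hausdorff space containing (a homeomorphic copy of) $X$ as a dense subspace. *)

(* Defs.v *)
From Stdlib Require Import Reals List.
Open Scope R_scope.

Definition topology (X : Type) := (X -> Prop) -> Prop.

Definition is_topology {X : Type} (T : topology X) : Prop :=
  T (fun _ => True) /\
  (forall U V, T U -> T V -> T (fun x => U x /\ V x)) /\
  (forall F : (X -> Prop) -> Prop,
     (forall U, F U -> T U) -> T (fun x => exists U, F U /\ U x)).

Definition continuous {X Y : Type} (TX : topology X) (TY : topology Y)
  (f : X -> Y) : Prop :=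
  forall V, TY V -> TX (fun x => V (f x)).

Definition embedding {X Y : Type} (TX : topology X) (TY : topology Y)
  (f : X -> Y) : Prop :=
  continuous TX TY f /\
  (forall x y, f x = f y -> x = y) /\
  (forall U, TX U -> exists V, TY V /\ forall x, U x <-> V (f x)).

Definition compact {X : Type} (T : topology X) : Prop :=
  forall F : (X -> Prop) -> Prop,
    (forall U, F U -> T U) ->
    (forall x, exists U, F U /\ U x) ->
    exists l : list (X -> Prop),
      (forall U, In U l -> F U) /\ (forall x, exists U, In U l /\ U x).

Definition compact_subset {X : Type} (T : topology X) (S : X -> Prop) : Prop :=
  forall F : (X -> Prop) -> Prop,
    (forall U, F U -> T U) ->
    (forall x, S x -> exists U, F U /\ U x) ->
    exists l : list (X -> Prop),
      (forall U, In U l -> F U) /\ (forall x, S x -> exists U, In U l /\ U x).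

Definition hausdorff {X : Type} (T : topology X) : Prop :=
  forall x y, x <> y ->
    exists U V, T U /\ T V /\ U x /\ V y /\ forall z, ~ (U z /\ V z).

Definition first_countable {X : Type} (T : topology X) : Prop :=
  forall x, exists B : nat -> (X -> Prop),
    (forall n, T (B n) /\ B n x) /\
    (forall U, T U -> U x -> exists n, forall z, B n z -> U z).

Definition is_metric {X : Type} (d : X -> X -> R) : Prop :=
  (forall x y, 0 <= d x y) /\
  (forall x y, d x y = 0 <-> x = y) /\
  (forall x y, d x y = d y x) /\
  (forall x y z, d x z <= d x y + d y z).

Definition metrizable {X : Type} (T : topology X) : Prop :=
  exists d : X -> X -> R, is_metric d /\
    forall U, T U <-> (forall x, U x -> exists eps, 0 < eps /\
                                    forall y, d x y < eps -> U y).

Definition compactification {X K : Type} (TX : topology X) (TK : topology K)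
  (e : X -> K) : Prop :=
  is_topology TK /\ compact TK /\ hausdorff TK /\ embedding TX TK e /\
  (forall V, TK V -> (exists k, V k) -> exists x, V (e x)).

Record hilbert_space := HilbertSpace {
  hcarrier :> Type;
  hzero : hcarrier;
  hadd : hcarrier -> hcarrier -> hcarrier;
  hopp : hcarrier -> hcarrier;
  hscal : R -> hcarrier -> hcarrier;
  hinner : hcarrier -> hcarrier -> R;
  hadd_assoc : forall x y z, hadd x (hadd y z) = hadd (hadd x y) z;
  hadd_comm : forall x y, hadd x y = hadd y x;
  hadd_zero : forall x, hadd x hzero = x;
  hadd_opp : forall x, hadd x (hopp x) = hzero;
  hscal_one : forall x, hscal 1 x = x;
  hscal_assoc : forall a b x, hscal a (hscal b x) = hscal (a * b) x;
  hscal_distr_l : forall a x y, hscal a (hadd x y) = hadd (hscal a x) (hscal a y);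
  hscal_distr_r : forall a b x, hscal (a + b) x = hadd (hscal a x) (hscal b x);
  hinner_sym : forall x y, hinner x y = hinner y x;
  hinner_add : forall x y z, hinner (hadd x y) z = hinner x z + hinner y z;
  hinner_scal : forall a x y, hinner (hscal a x) y = a * hinner x y;
  hinner_pos : forall x, 0 <= hinner x x;
  hinner_def : forall x, hinner x x = 0 -> x = hzero;
  hcomplete : forall u : nat -> hcarrier,
    (forall eps, 0 < eps -> exists N, forall m n, (N <= m)%nat -> (N <= n)%nat ->
        sqrt (hinner (hadd (u m) (hopp (u n))) (hadd (u m) (hopp (u n)))) < eps) ->
    exists l, forall eps, 0 < eps -> exists N, forall n, (N <= n)%nat ->
        sqrt (hinner (hadd (u n) (hopp l)) (hadd (u n) (hopp l))) < eps
}.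

Definition weak_topology (H : hilbert_space) : topology H :=
  fun U => forall x, U x -> exists (l : list H) (eps : R), 0 < eps /\
    forall z, (forall y, In y l -> Rabs (hinner H (hadd H z (hopp H x)) y) < eps) -> U z.

Definition uniform_eberlein {K : Type} (TK : topology K) : Prop :=
  exists (H : hilbert_space) (h : K -> H),
    embedding TK (weak_topology H) h /\
    compact_subset (weak_topology H) (fun y => exists k, h k = y).

(* Main.v *)
(* If [X] embeds in a first countable compact Hausdorff space [K], then
   [|K| <= c] by Arhangel'skii's theorem: every point of [K] is the value of a
   well-founded countably branching tree, and there are continuum many trees.

   Conversely, by Stone's theorem a metrizable [X] carries continuous functions [a k]
   and maps [s k], locally constant where [a k > 0], such that the sets
   [{x | a k x > 0 and s k x = t}] form a base. This embeds [X] in a countable product of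
   hedgehogs with spines indexed by [X]. An injection [phi] of [X] into [[-1, 1]] serves to
   replace the one-point compactification of the set of spines, which is not first
   countable, by the Alexandroff duplicate of an interval: to the coordinates [a k]
   and [a k] on the spine [s k] of the [k]-th hedgehog one adds [a k * phi (s k)]. The
   closure of the image, in the topology of pointwise convergence, is bounded in
   [l2], so it is uniform Eberlein, and the neighbourhoods of each of its points
   depend on countably many coordinates only. *)
From Stdlib Require Import Reals List Permutation Cantor Lra Lia Classical ClassicalEpsilon FunctionalExtensionality.
From mathcomp Require boolp wochoice.
Require Import Defs.

(** * Compactness of bounded closed sets in the topology of pointwise convergence *)

Lemma well_order_exists (T : Type) : exists lt : T -> T -> Prop,
  well_founded lt /\ (forall x y, x = y \/ lt x y \/ lt y x).
Proof.
destruct (wochoice.well_ordering_principle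
  (boolp.boolp_classicType__canonical__eqtype_Equality T)) as [r wo].
assert (Hmin : forall A : T -> Prop, (exists x, A x) ->
  exists z, (A z /\ forall x, A x -> r z x = true) /\
    forall y, A y /\ (forall x, A x -> r y x = true) -> z = y).
{ intros A [x Ax].
  set (p := fun x => if excluded_middle_informative (A x) then true else false).
  assert (Hp : forall x, p x = true <-> A x).
  { intro y; unfold p; destruct (excluded_middle_informative (A y)); split; easy. }
  destruct (wo p) as [z [[Hz1 Hz2] Hu]].
  { exists x; now apply Hp. }
  exists z; split.
  - split; [now apply Hp | intros y Hy; apply Hz2; now apply Hp].
  - intros y [Hy1 Hy2]; apply Hu; split; [now apply Hp |].
    intros w Hw; apply Hy2; now apply Hp. }
(* The negated converse of [r] is its strict part. Trichotomy uses reflexivity and antisymmetry of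
   [r], which come from the unique least elements of one- and two-point sets. *)
exists (fun x y => r y x <> true); split.
- intro x; apply NNPP; intro Hx.
  destruct (Hmin _ (ex_intro (fun x => ~ Acc _ x) x Hx)) as [z [[Hz Hlb] _]].
  apply Hz; constructor; intros y Hy; apply NNPP; intro Hn; exact (Hy (Hlb y Hn)).
- intros x y.
  destruct (classic (r x y = true)) as [Hxy|Hxy]; [|tauto].
  destruct (classic (r y x = true)) as [Hyx|Hyx]; [|tauto].
  assert (Hrefl : forall u, r u u = true).
  { intro u; destruct (Hmin (fun v => v = u)) as [z [[-> Hz] _]]; [now exists u|].
    now apply Hz. }
  left; destruct (Hmin (fun v => v = x \/ v = y)) as [z [_ Hu]]; [exists x; now left|].
  transitivity z; [symmetry|]; apply Hu; split; auto; intros v [-> | ->]; auto.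
Qed.

(** Well-foundedness excludes cycles of length two and three; trichotomy then leaves only
    [lt x z]. *)
Lemma well_order_trans {T : Type} (lt : T -> T -> Prop) :
  well_founded lt -> (forall x y, x = y \/ lt x y \/ lt y x) ->
  forall x y z, lt x y -> lt y z -> lt x z.
Proof.
intros wf tri x y z Hxy Hyz.
assert (H2 : forall a b, lt a b -> lt b a -> False).
{ intro a; induction (wf a) as [a _ IH]; intros b Hab Hba; exact (IH b Hba a Hba Hab). }
assert (H3 : forall a b c, lt a b -> lt b c -> lt c a -> False).
{ intro a; induction (wf a) as [a _ IH]; intros b c Hab Hbc Hca.
  exact (IH c Hca a b Hca Hab Hbc). }
destruct (tri x z) as [-> | [H | H]]; [destruct (H2 _ _ Hxy Hyz) | exact H |].
destruct (H3 _ _ _ Hxy Hyz H).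
Qed.

(** Serves the transfinite induction in [pointwise_compact]: the coordinates of a finite list that
    precede [g] all lie at or below a single [m] that precedes [g]. *)
Lemma max_in_list {T : Type} (lt : T -> T -> Prop) (S : T -> Prop) :
  well_founded lt -> (forall x y, x = y \/ lt x y \/ lt y x) ->
  forall l, (forall x, In x l -> ~ S x) \/
    exists m, S m /\ forall x, In x l -> S x -> x = m \/ lt x m.
Proof.
intros wf tri l; pose proof (well_order_trans lt wf tri) as tr.
induction l as [|a l IH]; [now left|].
destruct (classic (S a)) as [Ha|Ha].
- right; destruct IH as [IH | [m [Hm IH]]].
  + exists a; split; [exact Ha|]; intros x [<- | Hx] Sx; [now left | destruct (IH x Hx Sx)].
  + destruct (tri a m) as [-> | [H | H]].
    * exists m; split; [exact Hm|]; intros x [<- | Hx] Sx; auto.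
    * exists m; split; [exact Hm|]; intros x [<- | Hx] Sx; auto.
    * exists a; split; [exact Ha|]; intros x [<- | Hx] Sx; auto.
      destruct (IH x Hx Sx) as [-> | H']; eauto.
- destruct IH as [IH | [m [Hm IH]]].
  + left; intros x [<- | Hx]; auto.
  + right; exists m; split; [exact Hm|]; intros x [<- | Hx] Sx; [easy|auto].
Qed.

(** [S] is the set of coordinates fixed so far, so that [z] can stand for a partial point. *)
Definition near {G : Type} (S : G -> Prop) (l : list G) (eps : R) (z z' : G -> R) : Prop :=
  forall g, In g l -> S g -> Rabs (z' g - z g) < eps.

Definition pointwise {G : Type} (K : (G -> R) -> Prop) : topology {z | K z} :=
  fun U => forall z, U z -> exists l eps, 0 < eps /\
    forall z', near (fun _ => True) l eps (proj1_sig z) (proj1_sig z') -> U z'.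

(** These sets form an ideal; compactness is proved by finding a point none of whose neighbourhoods
    belongs to it. *)
Definition small {X : Type} (F : (X -> Prop) -> Prop) (Q : X -> Prop) : Prop :=
  exists l, (forall U, In U l -> F U) /\ forall x, Q x -> exists U, In U l /\ U x.

Lemma small_sub {X : Type} (F : (X -> Prop) -> Prop) (P Q : X -> Prop) :
  (forall x, P x -> Q x) -> small F Q -> small F P.
Proof. intros H [l [Hl HQ]]; exists l; auto. Qed.

Lemma small_union {X : Type} (F : (X -> Prop) -> Prop) (P P1 P2 : X -> Prop) :
  (forall x, P x -> P1 x \/ P2 x) -> small F P1 -> small F P2 -> small F P.
Proof.
intros H [l1 [H1 K1]] [l2 [H2 K2]]; exists (l1 ++ l2); split.
- intros U HU; apply in_app_or in HU; destruct HU; auto.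
- intros x Px; destruct (H x Px) as [Hx | Hx];
    [destruct (K1 x Hx) as [U [HU Ux]] | destruct (K2 x Hx) as [U [HU Ux]]];
    exists U; split; auto; apply in_or_app; auto.
Qed.

Lemma small_empty {X : Type} (F : (X -> Prop) -> Prop) (P : X -> Prop) :
  (forall x, ~ P x) -> small F P.
Proof. intro H; exists nil; split; [easy | intros x Px; destruct (H x Px)]. Qed.

(* The value [v] is the supremum of the [t] for which [t <= z' g] stays large
   on every neighbourhood of the partial point [z]. *)
Lemma extend_large {G : Type} (K : (G -> R) -> Prop) (F : ({z | K z} -> Prop) -> Prop)
  (g : G) (M : R) (S : G -> Prop) (z : G -> R) :
  (forall z, K z -> Rabs (z g) <= M) ->
  (forall l eps, 0 < eps -> ~ small F (fun z' => near S l eps z (proj1_sig z'))) ->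
  exists v, forall l eps, 0 < eps ->
    ~ small F (fun z' => near S l eps z (proj1_sig z') /\ Rabs (proj1_sig z' g - v) < eps).
Proof.
intros HM Hbig.
set (L := fun t => forall l eps, 0 < eps ->
  ~ small F (fun z' => near S l eps z (proj1_sig z') /\ t <= proj1_sig z' g)).
destruct (completeness L) as [v [Hub Hlub]].
- exists (M + 1); intros t Ht; apply Rnot_lt_le; intro Hlt.
  apply (Ht nil 1); [lra|]; apply small_empty; intros [z' Kz'] [_ Hz']; simpl in Hz'.
  specialize (HM z' Kz'); unfold Rabs in HM; destruct (Rcase_abs (z' g)); lra.
- exists (- M); intros l eps He Hs; apply (Hbig l eps He); revert Hs; apply small_sub.
  intros [z' Kz'] Hz'; split; [exact Hz'|]; simpl.
  specialize (HM z' Kz'); unfold Rabs in HM; destruct (Rcase_abs (z' g)); lra.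
- exists v; intros l eps He Hs.
  (* On some neighbourhood the part above [v + eps / 2] is small, while for some [t > v - eps / 2]
     the part above [t] never is. The band between them, which lies within [eps] of [v], therefore
     cannot be small. *)
  assert (Hv : ~ L (v + eps / 2)) by (intro H; specialize (Hub _ H); lra).
  assert (Hex : exists l' eps', 0 < eps' /\
    small F (fun z' => near S l' eps' z (proj1_sig z') /\ v + eps / 2 <= proj1_sig z' g)).
  { apply NNPP; intro Hn; apply Hv; intros l' eps' He' Hs'; apply Hn; eauto. }
  destruct Hex as [l' [eps' [He' Hs']]].
  assert (Ht : exists t, L t /\ v - eps / 2 < t).
  { apply NNPP; intro Hn; assert (v <= v - eps / 2); [|lra].
    apply Hlub; intros t Lt; apply Rnot_lt_le; intro; apply Hn; eauto. }
  destruct Ht as [t [Lt Hvt]].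
  apply (Lt (l ++ l') (Rmin eps eps')); [now apply Rmin_pos|].
  eapply small_union; [|exact Hs|exact Hs'].
  intros [z' Kz'] [Hn Htz]; simpl in *.
  assert (Hn1 : near S l eps z z').
  { intros b Hb Sb; eapply Rlt_le_trans; [apply Hn; auto; apply in_or_app; now left | apply Rmin_l]. }
  assert (Hn2 : near S l' eps' z z').
  { intros b Hb Sb; eapply Rlt_le_trans; [apply Hn; auto; apply in_or_app; now right | apply Rmin_r]. }
  destruct (Rle_or_lt (v + eps / 2) (z' g)); [now right | left; split; [exact Hn1|]].
  apply Rabs_def1; lra.
Qed.

(* Tychonoff's theorem for bounded closed sets. Given a cover without finite
   subcover, the coordinates of a point all of whose neighbourhoods are not
   finitely covered are chosen by transfinite recursion. *)
Lemma pointwise_compact {G : Type} (K : (G -> R) -> Prop) :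
  (forall g, exists M, forall z, K z -> Rabs (z g) <= M) ->
  (forall z, (forall l eps, 0 < eps -> exists z', K z' /\ near (fun _ => True) l eps z z') -> K z) ->
  compact (pointwise K).
Proof.
intros Hbd Hcl F HF Hcov; apply NNPP; intro Hno.
assert (Hbig : ~ small F (fun _ => True)).
{ intros [l [H1 H2]]; apply Hno; exists l; split; auto. }
clear Hno; destruct (well_order_exists G) as [lt [wf tri]].
set (ext := fun g (z : G -> R) v => forall l eps, 0 < eps ->
  ~ small F (fun z' => near (fun b => lt b g) l eps z (proj1_sig z')
                       /\ Rabs (proj1_sig z' g - v) < eps)).
(* The default 0 is harmless, since [ext g] looks only at coordinates below [g]. *)
set (total := fun g (rec : forall b, lt b g -> R) b =>
  match excluded_middle_informative (lt b g) with left h => rec b h | right _ => 0 end).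
set (z := Fix wf (fun _ => R) (fun g rec => epsilon (inhabits 0) (ext g (total g rec)))).
assert (Hz : forall g, (exists v, ext g z v) -> ext g z (z g)).
{ intros g [v Hv].
  assert (Hext : forall v, ext g (total g (fun b _ => z b)) v <-> ext g z v).
  { assert (Hnear : forall l eps z', near (fun b => lt b g) l eps (total g (fun b _ => z b)) z'
                     <-> near (fun b => lt b g) l eps z z').
    { intros l eps z'; unfold near, total; split; intros H b Hb Hlt; specialize (H b Hb Hlt);
        destruct (excluded_middle_informative (lt b g)); easy. }
    intro w; split; intros H l eps He Hs; apply (H l eps He); revert Hs; apply small_sub;
      intros z' [H1 H2]; split; auto; now apply Hnear. }
  unfold z at 2; rewrite Fix_eq.
  - fold z; apply Hext, epsilon_spec; exists v; now apply Hext.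
  - intros x f f' Hff; replace f' with f; [reflexivity|].
    apply functional_extensionality_dep; intro b; apply functional_extensionality_dep; auto. }
(* The hypothesis of [extend_large] at [g] follows from the induction hypothesis at the largest
   listed coordinate below [g], or from [Hbig] if there is none. *)
assert (Hle : forall g l eps, 0 < eps ->
  ~ small F (fun z' => near (fun b => b = g \/ lt b g) l eps z (proj1_sig z'))).
{ intro g; induction (wf g) as [g _ IH]; intros l eps He Hs.
  destruct (Hbd g) as [M HM].
  assert (Hg : ext g z (z g)).
  { apply Hz, (extend_large K F g M); [exact HM|].
    intros l' eps' He' Hs'.
    destruct (max_in_list lt (fun b => lt b g) wf tri l') as [Hl | [m [Hm Hl]]].
    - apply Hbig; revert Hs'; apply small_sub; intros z' _ b Hb Hlt; destruct (Hl b Hb Hlt).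
    - apply (IH m Hm l' eps' He'); revert Hs'; apply small_sub.
      intros z' Hz' b Hb Hlt; apply Hz'; auto. }
  apply (Hg l eps He); revert Hs; apply small_sub.
  intros z' [H1 H2] b Hb [-> | Hlt]; auto. }
assert (Hall : forall l eps, 0 < eps ->
  ~ small F (fun z' => near (fun _ => True) l eps z (proj1_sig z'))).
{ intros l eps He Hs.
  destruct (max_in_list lt (fun _ => True) wf tri l) as [Hl | [m [_ Hl]]].
  - apply Hbig; revert Hs; apply small_sub; intros z' _ b Hb Hlt; destruct (Hl b Hb Hlt).
  - apply (Hle m l eps He); revert Hs; apply small_sub; intros z' Hz' b Hb _; apply Hz'; auto. }
(* A neighbourhood of [z] that misses [K] would have empty trace on [K], hence be small. *)
assert (Kz : K z).
{ apply Hcl; intros l eps He; apply NNPP; intro Hn; apply (Hall l eps He), small_empty.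
  intros [z' Kz'] Hz'; apply Hn; now exists z'. }
destruct (Hcov (exist _ z Kz)) as [U [FU Uz]].
destruct (HF U FU _ Uz) as [l [eps [He HU]]].
apply (Hall l eps He); exists (U :: nil); split; [intros V [<- | []]; exact FU|].
intros z' Hz'; exists U; split; [now left | now apply HU].
Qed.

(** * Hilbert spaces of square summable families *)

Definition fsum {G : Type} (f : G -> R) (l : list G) : R := fold_right (fun g s => f g + s) 0 l.

Lemma fsum_plus {G : Type} (f h : G -> R) l : fsum (fun g => f g + h g) l = fsum f l + fsum h l.
Proof. induction l as [|a l IH]; simpl; lra. Qed.

Lemma fsum_scal {G : Type} c (f : G -> R) l : fsum (fun g => c * f g) l = c * fsum f l.
Proof. induction l as [|a l IH]; simpl; lra. Qed.

Lemma fsum_le {G : Type} (f h : G -> R) l :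
  (forall g, In g l -> f g <= h g) -> fsum f l <= fsum h l.
Proof.
induction l as [|a l IH]; simpl; intros H; [lra|].
assert (f a <= h a) by auto; assert (fsum f l <= fsum h l) by auto; lra.
Qed.

Lemma fsum_nonneg {G : Type} (f : G -> R) l : (forall g, 0 <= f g) -> 0 <= fsum f l.
Proof. intro H; induction l as [|a l IH]; simpl; [lra | specialize (H a); lra]. Qed.

Lemma fsum_app {G : Type} (f : G -> R) l l' : fsum f (l ++ l') = fsum f l + fsum f l'.
Proof. induction l as [|a l IH]; simpl; lra. Qed.

Lemma fsum_perm {G : Type} (f : G -> R) l l' : Permutation l l' -> fsum f l = fsum f l'.
Proof. induction 1; simpl; lra. Qed.

Lemma NoDup_cover {G : Type} (l : list G) : exists l', NoDup l' /\ incl l l'.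
Proof.
set (dec := fun x y : G => excluded_middle_informative (x = y)).
exists (nodup dec l); split; [apply NoDup_nodup | intros g Hg; now apply nodup_In].
Qed.

Lemma NoDup_complement {G : Type} (L l : list G) :
  NoDup L -> NoDup l -> incl L l -> exists r, Permutation l (L ++ r).
Proof.
intros HL; revert l; induction HL as [|a L Ha HL IH]; intros l Hl Hi.
- now exists l.
- destruct (in_split a l) as [l1 [l2 ->]]; [apply Hi; now left|].
  destruct (IH (l1 ++ l2)) as [r Hr].
  + now apply NoDup_remove_1 in Hl.
  + intros g Hg; assert (H : In g (l1 ++ a :: l2)) by (apply Hi; now right).
    apply in_app_or in H; apply in_or_app; destruct H as [H | [<- | H]]; [tauto | easy | tauto].
  + exists r; simpl; rewrite <- Hr; symmetry; apply Permutation_middle.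
Qed.

Lemma fsum_incl {G : Type} (f : G -> R) (L l : list G) :
  (forall g, 0 <= f g) -> NoDup L -> NoDup l -> incl L l -> fsum f L <= fsum f l.
Proof.
intros Hf HL Hl Hi; destruct (NoDup_complement L l HL Hl Hi) as [r Hr].
rewrite (fsum_perm f _ _ Hr), fsum_app; pose proof (fsum_nonneg f r Hf); lra.
Qed.

(** Unconditional summation: convergence along the net of finite subsets of [G], coded as lists
    without repetition. *)
Definition has_sum {G : Type} (f : G -> R) (s : R) : Prop :=
  forall eps, 0 < eps -> exists l0, forall l, NoDup l -> incl l0 l -> Rabs (fsum f l - s) < eps.

Lemma has_sum_unique {G : Type} (f : G -> R) s t : has_sum f s -> has_sum f t -> s = t.
Proof.
intros Hs Ht; apply NNPP; intro Hst.
assert (He : 0 < Rabs (s - t) / 2).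
{ assert (0 < Rabs (s - t)) by (apply Rabs_pos_lt; lra); lra. }
destruct (Hs _ He) as [l1 H1]; destruct (Ht _ He) as [l2 H2].
destruct (NoDup_cover (l1 ++ l2)) as [l [Hl Hi]].
specialize (H1 l Hl (fun g Hg => Hi g (in_or_app _ _ _ (or_introl Hg)))).
specialize (H2 l Hl (fun g Hg => Hi g (in_or_app _ _ _ (or_intror Hg)))).
revert H1 H2; unfold Rabs; repeat destruct Rcase_abs; lra.
Qed.

Lemma has_sum_plus {G : Type} (f h : G -> R) s t :
  has_sum f s -> has_sum h t -> has_sum (fun g => f g + h g) (s + t).
Proof.
intros Hs Ht eps He.
destruct (Hs (eps / 2) ltac:(lra)) as [l1 H1]; destruct (Ht (eps / 2) ltac:(lra)) as [l2 H2].
exists (l1 ++ l2); intros l Hl Hi.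
specialize (H1 l Hl (fun g Hg => Hi g (in_or_app _ _ _ (or_introl Hg)))).
specialize (H2 l Hl (fun g Hg => Hi g (in_or_app _ _ _ (or_intror Hg)))).
rewrite fsum_plus; apply Rabs_def2 in H1, H2; apply Rabs_def1; lra.
Qed.

Lemma has_sum_scal {G : Type} c (f : G -> R) s :
  has_sum f s -> has_sum (fun g => c * f g) (c * s).
Proof.
intros Hs eps He.
assert (Hc : 0 < Rabs c + 1) by (pose proof (Rabs_pos c); lra).
destruct (Hs (eps / (Rabs c + 1))) as [l0 H0]; [now apply Rdiv_lt_0_compat|].
exists l0; intros l Hl Hi; specialize (H0 l Hl Hi).
rewrite fsum_scal, <- Rmult_minus_distr_l, Rabs_mult.
apply Rle_lt_trans with (Rabs c * (eps / (Rabs c + 1))).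
- apply Rmult_le_compat_l; [apply Rabs_pos | lra].
- apply Rlt_le_trans with ((Rabs c + 1) * (eps / (Rabs c + 1))).
  + apply Rmult_lt_compat_r; [now apply Rdiv_lt_0_compat | lra].
  + right; field; lra.
Qed.

Lemma has_sum_ext {G : Type} (f h : G -> R) s :
  (forall g, f g = h g) -> has_sum f s -> has_sum h s.
Proof. intros H; now replace h with f by now apply functional_extensionality. Qed.

(** The sum is the supremum of the finite partial sums, which increase with the finite set. *)
Lemma has_sum_exists {G : Type} (f : G -> R) M :
  (forall g, 0 <= f g) -> (forall l, NoDup l -> fsum f l <= M) -> exists s, has_sum f s.
Proof.
intros Hf HM.
destruct (completeness (fun t => exists l, NoDup l /\ t = fsum f l)) as [s [Hub Hlub]].
- exists M; intros t [l [Hl ->]]; auto.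
- exists 0, nil; split; [constructor | reflexivity].
- exists s; intros eps He.
  assert (H : exists l0, NoDup l0 /\ s - eps < fsum f l0).
  { apply NNPP; intro Hn; assert (s <= s - eps); [|lra].
    apply Hlub; intros t [l [Hl ->]]; apply Rnot_lt_le; intro; apply Hn; eauto. }
  destruct H as [l0 [Hl0 H0]]; exists l0; intros l Hl Hi.
  pose proof (fsum_incl f l0 l Hf Hl0 Hl Hi).
  assert (fsum f l <= s) by (apply Hub; eauto).
  apply Rabs_def1; lra.
Qed.

Lemma has_sum_le {G : Type} (f : G -> R) s M :
  has_sum f s -> (forall l, NoDup l -> fsum f l <= M) -> s <= M.
Proof.
intros Hs HM; apply Rnot_lt_le; intro Hlt.
destruct (Hs (s - M) ltac:(lra)) as [l0 H0].
destruct (NoDup_cover l0) as [l [Hl Hi]].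
specialize (H0 l Hl Hi); specialize (HM l Hl); apply Rabs_def2 in H0; lra.
Qed.

Lemma has_sum_ge {G : Type} (f : G -> R) s l :
  (forall g, 0 <= f g) -> has_sum f s -> NoDup l -> fsum f l <= s.
Proof.
intros Hf Hs Hl; apply Rnot_lt_le; intro Hlt.
destruct (Hs (fsum f l - s) ltac:(lra)) as [l0 H0].
destruct (NoDup_cover (l ++ l0)) as [l' [Hl' Hi]].
specialize (H0 l' Hl' (fun g Hg => Hi g (in_or_app _ _ _ (or_intror Hg)))).
pose proof (fsum_incl f l l' Hf Hl Hl' (fun g Hg => Hi g (in_or_app _ _ _ (or_introl Hg)))).
apply Rabs_def2 in H0; lra.
Qed.

Lemma has_sum_tail {G : Type} (f : G -> R) s eps :
  (forall g, 0 <= f g) -> has_sum f s -> 0 < eps ->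
  exists L, NoDup L /\ forall r, NoDup (L ++ r) -> fsum f r <= eps.
Proof.
intros Hf Hs He; destruct (Hs eps He) as [l0 H0].
destruct (NoDup_cover l0) as [L [HL Hi]]; exists L; split; [exact HL|]; intros r Hr.
pose proof (has_sum_ge f s _ Hf Hs Hr) as H1; rewrite fsum_app in H1.
specialize (H0 L HL Hi); apply Rabs_def2 in H0; lra.
Qed.

(** [M] bounds the square of the norm, not the norm. *)
Definition sq_bounded {G : Type} (M : R) (x : G -> R) : Prop :=
  forall l, NoDup l -> fsum (fun g => x g * x g) l <= M.

Definition sq_summable {G : Type} (x : G -> R) : Prop := exists M, sq_bounded M x.

Lemma sq_summable_plus {G : Type} (x y : G -> R) :
  sq_summable x -> sq_summable y -> sq_summable (fun g => x g + y g).
Proof.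
intros [M HM] [N HN]; exists (2 * M + 2 * N); intros l Hl.
specialize (HM l Hl); specialize (HN l Hl).
apply Rle_trans with (fsum (fun g => 2 * (x g * x g) + 2 * (y g * y g)) l).
- apply fsum_le; intros g _; pose proof (Rle_0_sqr (x g - y g)) as H; unfold Rsqr in H; lra.
- rewrite fsum_plus, !fsum_scal; lra.
Qed.

Lemma sq_summable_scal {G : Type} c (x : G -> R) :
  sq_summable x -> sq_summable (fun g => c * x g).
Proof.
intros [M HM]; exists ((c * c) * M); intros l Hl.
replace (fsum _ l) with ((c * c) * fsum (fun g => x g * x g) l).
- apply Rmult_le_compat_l; [apply Rle_0_sqr | auto].
- rewrite <- fsum_scal; f_equal; apply functional_extensionality; intro; ring.
Qed.

Lemma sq_summable_zero {G : Type} : sq_summable (fun _ : G => 0).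
Proof. exists 0; intros l _; induction l as [|a l IH]; simpl; lra. Qed.

Lemma sqr_nonneg {G : Type} (x : G -> R) g : 0 <= x g * x g.
Proof. apply Rle_0_sqr. Qed.

Definition dot {G : Type} (x y : G -> R) : R :=
  epsilon (inhabits 0) (has_sum (fun g => x g * y g)).

(** By polarization the products are a combination of the squares of [x + y], [x] and [y], whose
    sums exist as suprema. *)
Lemma dot_has_sum {G : Type} (x y : G -> R) :
  sq_summable x -> sq_summable y -> has_sum (fun g => x g * y g) (dot x y).
Proof.
intros Hx Hy; apply (epsilon_spec (inhabits 0) (has_sum _)).
destruct (sq_summable_plus x y Hx Hy) as [P HP]; destruct Hx as [M HM]; destruct Hy as [N HN].
destruct (has_sum_exists _ P (sqr_nonneg (fun g => x g + y g)) HP) as [p Hp].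
destruct (has_sum_exists _ M (sqr_nonneg x) HM) as [m Hm].
destruct (has_sum_exists _ N (sqr_nonneg y) HN) as [n Hn].
exists (/ 2 * (p + -1 * (m + n))).
eapply has_sum_ext; [|apply has_sum_scal, has_sum_plus;
  [exact Hp | apply has_sum_scal, has_sum_plus; [exact Hm | exact Hn]]].
intro g; simpl; field.
Qed.

Lemma dot_eq {G : Type} (x y : G -> R) s :
  sq_summable x -> sq_summable y -> has_sum (fun g => x g * y g) s -> dot x y = s.
Proof. intros Hx Hy; apply has_sum_unique, dot_has_sum; auto. Qed.

Lemma dot_self_ge {G : Type} (x : G -> R) l :
  sq_summable x -> NoDup l -> fsum (fun g => x g * x g) l <= dot x x.
Proof. intros Hx; apply has_sum_ge; [apply sqr_nonneg | now apply dot_has_sum]. Qed.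

Lemma dot_self_le {G : Type} (x : G -> R) M : sq_bounded M x -> dot x x <= M.
Proof. intros HM; eapply has_sum_le; [|exact HM]; apply dot_has_sum; now exists M. Qed.

Lemma coord_le_norm {G : Type} (x : G -> R) g : sq_summable x -> Rabs (x g) <= sqrt (dot x x).
Proof.
intro Hx; rewrite <- sqrt_Rsqr_abs; apply sqrt_le_1_alt; unfold Rsqr.
pose proof (dot_self_ge x (g :: nil) Hx) as H; simpl in H; rewrite Rplus_0_r in H.
apply H; constructor; [easy | constructor].
Qed.

Definition l2 (G : Type) : Type := {x : G -> R | sq_summable x}.

Definition l2_zero {G : Type} : l2 G := exist _ _ sq_summable_zero.
Definition l2_add {G : Type} (x y : l2 G) : l2 G :=
  exist _ _ (sq_summable_plus _ _ (proj2_sig x) (proj2_sig y)).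
Definition l2_scal {G : Type} c (x : l2 G) : l2 G :=
  exist _ _ (sq_summable_scal c _ (proj2_sig x)).
Definition l2_opp {G : Type} (x : l2 G) : l2 G := l2_scal (-1) x.
Definition l2_dot {G : Type} (x y : l2 G) : R := dot (proj1_sig x) (proj1_sig y).

Lemma l2_ext {G : Type} (x y : l2 G) : (forall g, proj1_sig x g = proj1_sig y g) -> x = y.
Proof.
destruct x as [x Hx], y as [y Hy]; simpl; intro H.
apply functional_extensionality in H; subst y; f_equal; apply proof_irrelevance.
Qed.

Lemma Un_cv_fsum {G : Type} (f : nat -> G -> R) (h : G -> R) l :
  (forall g, Un_cv (fun n => f n g) (h g)) -> Un_cv (fun n => fsum (f n) l) (fsum h l).
Proof.
intro H; induction l as [|a l IH]; simpl.
- intros eps He; exists 0%nat; intros; unfold Rdist; rewrite Rminus_diag, Rabs_R0; lra.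
- apply (CV_plus (fun n => f n a) (fun n => fsum (f n) l)); auto.
Qed.

Lemma Un_cv_le (u : nat -> R) a M N : Un_cv u a -> (forall n, (N <= n)%nat -> u n <= M) -> a <= M.
Proof.
intros Hu HM; apply Rnot_lt_le; intro Hlt.
destruct (Hu (a - M) ltac:(lra)) as [K HK].
specialize (HK (max K N) ltac:(lia)); specialize (HM (max K N) ltac:(lia)).
unfold Rdist in HK; apply Rabs_def2 in HK; lra.
Qed.

Lemma l2_complete {G : Type} (u : nat -> l2 G) :
  (forall eps, 0 < eps -> exists N, forall m n, (N <= m)%nat -> (N <= n)%nat ->
     sqrt (l2_dot (l2_add (u m) (l2_opp (u n))) (l2_add (u m) (l2_opp (u n)))) < eps) ->
  exists l, forall eps, 0 < eps -> exists N, forall n, (N <= n)%nat ->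
     sqrt (l2_dot (l2_add (u n) (l2_opp l)) (l2_add (u n) (l2_opp l))) < eps.
Proof.
intro HC.
assert (Hlim : forall g, exists a, Un_cv (fun n => proj1_sig (u n) g) a).
{ intro g; destruct (R_complete (fun n => proj1_sig (u n) g)) as [a Ha]; [|eauto].
  intros eps He; destruct (HC eps He) as [N HN]; exists N; intros m n Hm Hn.
  eapply Rle_lt_trans; [|exact (HN m n Hm Hn)].
  pose proof (coord_le_norm (proj1_sig (l2_add (u m) (l2_opp (u n)))) g (proj2_sig _)) as H.
  simpl in H; unfold Rdist; eapply Rle_trans; [right | exact H]; f_equal; ring. }
apply choice in Hlim; destruct Hlim as [a Ha].
(* The Cauchy estimate bounds each finite partial sum, and finite sums pass to the coordinatewise
   limit in [n]; the bound does not depend on the finite set. *)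
assert (Hball : forall eps, 0 < eps -> exists N, forall m, (N <= m)%nat ->
  sq_bounded (eps * eps) (fun g => proj1_sig (u m) g + -1 * a g)).
{ intros eps He; destruct (HC eps He) as [N HN]; exists N; intros m Hm l Hl.
  apply (Un_cv_le (fun n => fsum (fun g => (proj1_sig (u m) g + -1 * proj1_sig (u n) g)
                                  * (proj1_sig (u m) g + -1 * proj1_sig (u n) g)) l) _ _ N).
  - apply Un_cv_fsum; intro g.
    assert (H : Un_cv (fun n => proj1_sig (u m) g + -1 * proj1_sig (u n) g)
                      (proj1_sig (u m) g + -1 * a g)).
    { apply (CV_plus (fun _ => proj1_sig (u m) g) (fun n => -1 * proj1_sig (u n) g)).
      - intros e He'; exists 0%nat; intros; unfold Rdist; rewrite Rminus_diag, Rabs_R0; lra.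
      - apply (CV_mult (fun _ => -1) (fun n => proj1_sig (u n) g)); [|apply Ha].
        intros e He'; exists 0%nat; intros; unfold Rdist; rewrite Rminus_diag, Rabs_R0; lra. }
    apply (CV_mult _ _ _ _ H H).
  - intros n Hn; specialize (HN m n Hm Hn).
    eapply Rle_trans; [apply (dot_self_ge (proj1_sig (l2_add (u m) (l2_opp (u n)))) l (proj2_sig _) Hl)|].
    unfold l2_dot in HN; set (p := dot _ _) in *.
    destruct (Rle_or_lt p 0); [nra|].
    rewrite <- (sqrt_sqrt p) by lra; pose proof (sqrt_pos p); nra. }
assert (Hsa : sq_summable a).
{ destruct (Hball 1 ltac:(lra)) as [N HN]; specialize (HN N (le_n N)).
  replace a with (fun g => proj1_sig (u N) g + -1 * (proj1_sig (u N) g + -1 * a g))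
    by (apply functional_extensionality; intro; ring).
  apply sq_summable_plus; [apply proj2_sig|]; apply sq_summable_scal; eexists; exact HN. }
exists (exist _ a Hsa); intros eps He.
destruct (Hball (eps / 2) ltac:(lra)) as [N HN]; exists N; intros n Hn; specialize (HN n Hn).
apply Rle_lt_trans with (eps / 2); [|lra].
rewrite <- (sqrt_square (eps / 2)) by lra; apply sqrt_le_1_alt.
exact (dot_self_le _ _ HN).
Qed.

Definition l2_hilbert (G : Type) : hilbert_space.
Proof.
refine (HilbertSpace (l2 G) l2_zero l2_add l2_opp l2_scal l2_dot
  _ _ _ _ _ _ _ _ _ _ _ _ _ l2_complete);
  try (intros; apply l2_ext; intro; simpl; ring).
- intros x y; unfold l2_dot, dot; f_equal; f_equal.
  apply functional_extensionality; intro; ring.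
- intros x y z; apply dot_eq; try apply proj2_sig.
  eapply has_sum_ext; [|apply has_sum_plus; apply dot_has_sum; apply proj2_sig].
  intro; simpl; ring.
- intros a x y; apply dot_eq; try apply proj2_sig.
  eapply has_sum_ext; [|apply has_sum_scal; apply dot_has_sum; apply proj2_sig].
  intro; simpl; ring.
- intro x; exact (dot_self_ge (proj1_sig x) nil (proj2_sig x) (NoDup_nil _)).
- intros x H; apply l2_ext; intro g; simpl.
  pose proof (coord_le_norm (proj1_sig x) g (proj2_sig x)) as Hg.
  unfold l2_dot in H; rewrite H, sqrt_0 in Hg.
  pose proof (Rabs_pos (proj1_sig x g)); apply NNPP; intro Hn; apply Rabs_no_R0 in Hn; lra.
Defined.

(** * The weak topology on bounded sets *)

(** Split [y] into finitely many coordinates, where [v] is close to 0, and a tail of small norm,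
    paired with the bounded [v]. *)
Lemma dot_small_near_zero {G : Type} (M eps : R) (y : G -> R) :
  sq_summable y -> 0 < eps ->
  exists l delta, 0 < delta /\ forall v, sq_bounded M v ->
    near (fun _ => True) l delta (fun _ => 0) v -> Rabs (dot v y) < eps.
Proof.
intros Hy He.
set (M' := Rmax M 0 + 1).
assert (HM' : 0 < M' /\ M <= M').
{ pose proof (Rmax_l M 0); pose proof (Rmax_r M 0); unfold M'; lra. }
(* The weight of the AM-GM inequality below: [eta * M' = eps / 4] bounds the contribution of [v],
   and a tail of [y] with squares summing to at most [eta * eps] contributes another [eps / 4]. *)
set (eta := eps / (4 * M')).
assert (Heta : 0 < eta) by (apply Rdiv_lt_0_compat; lra).
destruct (has_sum_tail _ _ (eta * eps) (sqr_nonneg y) (dot_has_sum y y Hy Hy)) as [L [HL Htail]];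
  [now apply Rmult_lt_0_compat|].
set (Y := fsum (fun g => Rabs (y g)) L).
assert (HY : 0 <= Y) by (apply fsum_nonneg; intro; apply Rabs_pos).
exists L, (eps / 4 / (Y + 1)); split; [apply Rdiv_lt_0_compat; lra|].
intros v Hv Hnear.
destruct (dot_has_sum v y (ex_intro _ M Hv) Hy (eps / 4) ltac:(lra)) as [l0 H0].
destruct (NoDup_cover (L ++ l0)) as [l [Hl Hi]].
specialize (H0 l Hl (fun g Hg => Hi g (in_or_app _ _ _ (or_intror Hg)))).
destruct (NoDup_complement L l HL Hl (fun g Hg => Hi g (in_or_app _ _ _ (or_introl Hg)))) as [r Hr].
assert (Hlr : NoDup (L ++ r)) by exact (Permutation_NoDup Hr Hl).
rewrite (fsum_perm _ _ _ Hr), fsum_app in H0.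
assert (H1 : Rabs (fsum (fun g => v g * y g) L) <= eps / 4).
{ apply Rle_trans with (eps / 4 / (Y + 1) * Y).
  - revert Hnear; generalize (eps / 4 / (Y + 1)) as d; intros d Hnear; unfold Y; clear - Hnear.
    induction L as [|a L IH]; simpl; [rewrite Rabs_R0; lra|].
    eapply Rle_trans; [apply Rabs_triang|].
    rewrite Rmult_plus_distr_l, Rabs_mult; apply Rplus_le_compat.
    + apply Rmult_le_compat_r; [apply Rabs_pos|].
      specialize (Hnear a (or_introl eq_refl) I); cbv beta in Hnear; rewrite Rminus_0_r in Hnear; lra.
    + apply IH; intros g Hg; apply Hnear; now right.
  - apply Rle_trans with (eps / 4 / (Y + 1) * (Y + 1)); [|right; field; lra].
    apply Rmult_le_compat_l; [left; apply Rdiv_lt_0_compat; lra | lra]. }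
(* AM-GM: [|v y| <= eta v^2 + y^2 / (4 eta)] on the tail *)
assert (Ham : forall g, Rabs (v g * y g) <= eta * (v g * v g) + / (4 * eta) * (y g * y g)).
{ intro g; rewrite Rabs_mult.
  replace (v g * v g) with (Rabs (v g) * Rabs (v g)) by (rewrite <- Rabs_mult; apply Rabs_pos_eq, Rle_0_sqr).
  replace (y g * y g) with (Rabs (y g) * Rabs (y g)) by (rewrite <- Rabs_mult; apply Rabs_pos_eq, Rle_0_sqr).
  generalize (Rabs (v g)) (Rabs (y g)); intros p q.
  apply Rminus_le.
  replace (p * q - _) with (- (/ (4 * eta) * Rsqr (2 * eta * p - q))) by (unfold Rsqr; field; lra).
  assert (0 <= / (4 * eta) * Rsqr (2 * eta * p - q)); [|lra].
  apply Rmult_le_pos; [left; apply Rinv_0_lt_compat; lra | apply Rle_0_sqr]. }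
assert (H2 : Rabs (fsum (fun g => v g * y g) r) <= eps / 4 + eps / 4).
{ apply Rle_trans with (fsum (fun g => eta * (v g * v g) + / (4 * eta) * (y g * y g)) r).
  - clear - Ham; induction r as [|a r IH]; simpl; [rewrite Rabs_R0; lra|].
    eapply Rle_trans; [apply Rabs_triang|]; apply Rplus_le_compat; auto.
  - rewrite fsum_plus, !fsum_scal; apply Rplus_le_compat.
    + apply Rle_trans with (eta * M'); [|right; unfold eta; field; lra].
      apply Rmult_le_compat_l; [lra|]; apply Rle_trans with M; [|lra].
      apply Hv; now apply NoDup_app_remove_l in Hlr.
    + apply Rle_trans with (/ (4 * eta) * (eta * eps)); [|right; field; lra].
      apply Rmult_le_compat_l; [left; apply Rinv_0_lt_compat; lra | now apply Htail]. }
revert H0 H1 H2; unfold Rabs; repeat destruct Rcase_abs; lra.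
Qed.

Lemma compact_image {X Y : Type} (TX : topology X) (TY : topology Y) (f : X -> Y) :
  compact TX -> continuous TX TY f -> compact_subset TY (fun y => exists x, f x = y).
Proof.
intros HK Hf F HF Hcov.
destruct (HK (fun V => exists U, F U /\ V = fun x => U (f x))) as [l [Hl1 Hl2]].
- intros V [U [HU ->]]; apply Hf; auto.
- intro x; destruct (Hcov (f x)) as [U [HU Ux]]; [now exists x|].
  exists (fun x => U (f x)); split; [now exists U | exact Ux].
- assert (H : exists l', (forall U, In U l' -> F U) /\
    forall V, In V l -> exists U, In U l' /\ V = fun x => U (f x)).
  { clear Hl2; induction l as [|V l IH]; [now exists nil|].
    destruct IH as [l' [H1 H2]]; [intros; apply Hl1; now right|].
    destruct (Hl1 V (or_introl eq_refl)) as [U [HU ->]].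
    exists (U :: l'); split; [intros W [<- | HW]; auto|].
    intros W [<- | HW]; [exists U; split; [now left | reflexivity]|].
    destruct (H2 W HW) as [U' [HU' ->]]; exists U'; split; [now right | reflexivity]. }
  destruct H as [l' [H1 H2]]; exists l'; split; [exact H1|].
  intros y [x <-]; destruct (Hl2 x) as [V [HV Vx]]; destruct (H2 V HV) as [U [HU ->]]; eauto.
Qed.

Definition unit_vector {G : Type} (g : G) : G -> R :=
  fun b => if excluded_middle_informative (b = g) then 1 else 0.

Lemma fsum_unit {G : Type} (x : G -> R) g l :
  NoDup l -> In g l -> fsum (fun b => x b * unit_vector g b) l = x g.
Proof.
assert (H0 : forall l, ~ In g l -> fsum (fun b => x b * unit_vector g b) l = 0).
{ clear l; induction l as [|a l IH]; simpl; intro H; [reflexivity|].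
  rewrite IH by tauto; unfold unit_vector.
  destruct (excluded_middle_informative (a = g)); [tauto | ring]. }
induction 1 as [|a l Ha Hl IH]; simpl; [easy|].
intros [-> | Hg].
- rewrite H0 by assumption; unfold unit_vector.
  destruct (excluded_middle_informative (g = g)); [ring | easy].
- rewrite IH by assumption; unfold unit_vector.
  destruct (excluded_middle_informative (a = g)); [now subst | ring].
Qed.

Lemma has_sum_unit {G : Type} (x : G -> R) g : has_sum (fun b => x b * unit_vector g b) (x g).
Proof.
intros eps He; exists (g :: nil); intros l Hl Hi.
rewrite fsum_unit; [rewrite Rminus_diag, Rabs_R0; lra | exact Hl | apply Hi; now left].
Qed.

Lemma unit_vector_sq_summable {G : Type} (g : G) : sq_summable (unit_vector g).
Proof.
exists 1; intros l Hl.
destruct (classic (In g l)) as [Hg | Hg].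
- rewrite fsum_unit by assumption; unfold unit_vector.
  destruct (excluded_middle_informative (g = g)); [lra | easy].
- apply Rle_trans with (fsum (fun _ => 0 * 0) l).
  + apply fsum_le; intros b Hb; unfold unit_vector.
    destruct (excluded_middle_informative (b = g)); [now subst | lra].
  + clear; induction l; simpl; lra.
Qed.

Lemma sq_bounded_minus {G : Type} M (x y : G -> R) :
  sq_bounded M x -> sq_bounded M y -> sq_bounded (4 * M) (fun g => x g + -1 * y g).
Proof.
intros Hx Hy l Hl; specialize (Hx l Hl); specialize (Hy l Hl).
apply Rle_trans with (fsum (fun g => 2 * (x g * x g) + 2 * (y g * y g)) l).
- apply fsum_le; intros g _; pose proof (Rle_0_sqr (x g + y g)) as H; unfold Rsqr in H; lra.
- rewrite fsum_plus, !fsum_scal; lra.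
Qed.

Lemma near_app {G : Type} (S : G -> Prop) l1 l2 e1 e2 (z z' : G -> R) :
  near S (l1 ++ l2) (Rmin e1 e2) z z' -> near S l1 e1 z z' /\ near S l2 e2 z z'.
Proof.
intro H; split; intros g Hg Sg; eapply Rlt_le_trans;
  [apply H; auto; apply in_or_app; now left | apply Rmin_l |
   apply H; auto; apply in_or_app; now right | apply Rmin_r].
Qed.

(* On bounded subsets of [l2] the weak topology is the topology of pointwise
   convergence. *)
Lemma bounded_uniform_eberlein {G : Type} (K : (G -> R) -> Prop) (M : R) :
  (forall z, K z -> sq_bounded M z) -> compact (pointwise K) -> uniform_eberlein (pointwise K).
Proof.
intros HM Hc.
set (h := fun z : {z | K z} =>
  exist (@sq_summable G) (proj1_sig z) (ex_intro _ M (HM _ (proj2_sig z))) : l2_hilbert G).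
assert (Hcont : continuous (pointwise K) (weak_topology (l2_hilbert G)) h).
{ intros V HV z Vz; destruct (HV _ Vz) as [ys [eps [He HVz]]].
  assert (H : exists l delta, 0 < delta /\ forall z', near (fun _ => True) l delta (proj1_sig z) (proj1_sig z') ->
    forall y, In y ys ->
      Rabs (hinner (l2_hilbert G) (hadd _ (h z') (hopp _ (h z))) y) < eps).
  { clear HVz; induction ys as [|y ys IH]; [exists nil, 1; split; [lra | easy]|].
    destruct IH as [l1 [d1 [Hd1 H1]]].
    (* The difference of two points of [K] has squared norm at most [4 * M]. *)
    destruct (dot_small_near_zero (4 * M) eps (proj1_sig y) (proj2_sig y) He) as [l2 [d2 [Hd2 H2]]].
    exists (l1 ++ l2), (Rmin d1 d2); split; [now apply Rmin_pos|].
    intros z' Hz'; apply near_app in Hz'; destruct Hz' as [Hz1 Hz2].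
    intros w [<- | Hw]; [|exact (H1 z' Hz1 w Hw)].
    apply H2.
    - exact (sq_bounded_minus M _ _ (HM _ (proj2_sig z')) (HM _ (proj2_sig z))).
    - intros g Hg _; simpl; specialize (Hz2 g Hg I).
      replace (_ - 0) with (proj1_sig z' g - proj1_sig z g) by ring; exact Hz2. }
  destruct H as [l [delta [Hd H]]]; exists l, delta; split; [exact Hd|].
  intros z' Hz'; apply HVz, H, Hz'. }
exists (l2_hilbert G), h; split; [|now apply compact_image with (TX := pointwise K)].
split; [exact Hcont | split].
- intros x y Hxy; apply (f_equal (@proj1_sig _ _)) in Hxy; simpl in Hxy.
  destruct x as [x Hx], y as [y Hy]; simpl in Hxy; subst y; f_equal; apply proof_irrelevance.
- intros U HU.
  (* The union of all basic weak neighbourhoods whose trace on the image lies in the image of [U],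
     presented by its centres; halving the radius shows that it is open. *)
  exists (fun y => exists l eps, 0 < eps /\ forall z, (forall v, In v l ->
    Rabs (hinner (l2_hilbert G) (hadd _ (h z) (hopp _ y)) v) < eps) -> U z).
  split.
  + intros y [l [eps [He H]]]; exists l, (eps / 2); split; [lra|].
    intros y' Hy'; exists l, (eps / 2); split; [lra|].
    intros z Hz; apply H; intros v Hv; specialize (Hy' v Hv); specialize (Hz v Hv).
    replace (hadd _ (h z) (hopp _ y)) with
      (hadd (l2_hilbert G) (hadd _ (h z) (hopp _ y')) (hadd _ y' (hopp _ y)))
      by (apply (@l2_ext G); intro; simpl; ring).
    rewrite hinner_add; apply Rabs_def2 in Hy', Hz; apply Rabs_def1; lra.
  + intro z; split.
    * intro Uz; destruct (HU z Uz) as [l [eps [He H]]].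
      (* Pairing with unit vectors reads off the coordinates. *)
      exists (map (fun g => exist (@sq_summable G) _ (unit_vector_sq_summable g)) l), eps.
      split; [exact He|]; intros z' Hz'; apply H; intros g Hg _.
      specialize (Hz' _ (in_map (fun g => exist (@sq_summable G) _ (unit_vector_sq_summable g)) l g Hg)); simpl in Hz'; unfold l2_dot in Hz'.
      rewrite (dot_eq _ _ (proj1_sig z' g + -1 * proj1_sig z g)) in Hz'.
      -- replace (_ - _) with (proj1_sig z' g + -1 * proj1_sig z g) by ring; exact Hz'.
      -- apply proj2_sig.
      -- apply unit_vector_sq_summable.
      -- exact (has_sum_unit (fun g => proj1_sig z' g + -1 * proj1_sig z g) g).
    * intros [l [eps [He H]]]; apply H; intros v _.
      rewrite hadd_opp; replace (hzero _) with (hscal (l2_hilbert G) 0 (hzero _))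
        by (apply (@l2_ext G); intro; simpl; ring).
      rewrite hinner_scal, Rmult_0_l, Rabs_R0; exact He.
Qed.

(** * Separation and countability in the topology of pointwise convergence *)

Lemma pointwise_is_topology {G : Type} (K : (G -> R) -> Prop) : is_topology (pointwise K).
Proof.
split; [|split].
- intros z _; exists nil, 1; split; [lra | easy].
- intros U V HU HV z [Uz Vz].
  destruct (HU z Uz) as [l1 [e1 [He1 H1]]]; destruct (HV z Vz) as [l2 [e2 [He2 H2]]].
  exists (l1 ++ l2), (Rmin e1 e2); split; [now apply Rmin_pos|].
  intros z' Hz'; apply near_app in Hz'; split; [apply H1 | apply H2]; tauto.
- intros F HF z [U [FU Uz]]; destruct (HF U FU z Uz) as [l [e [He H]]].
  exists l, e; split; [exact He|]; intros z' Hz'; exists U; auto.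
Qed.

Lemma open_coord_between {G : Type} (K : (G -> R) -> Prop) g a b :
  pointwise K (fun z => a < proj1_sig z g < b).
Proof.
intros z Hz; exists (g :: nil), (Rmin (proj1_sig z g - a) (b - proj1_sig z g)).
split; [apply Rmin_pos; lra|]; intros z' Hz'.
specialize (Hz' g (or_introl eq_refl) I); apply Rabs_def2 in Hz'.
pose proof (Rmin_l (proj1_sig z g - a) (b - proj1_sig z g)).
pose proof (Rmin_r (proj1_sig z g - a) (b - proj1_sig z g)); lra.
Qed.

Lemma pointwise_hausdorff {G : Type} (K : (G -> R) -> Prop) : hausdorff (pointwise K).
Proof.
intros z w Hzw.
assert (H : exists g, proj1_sig z g <> proj1_sig w g).
{ apply NNPP; intro Hn; apply Hzw; destruct z as [z Kz], w as [w Kw]; simpl in Hn.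
  assert (z = w); [|subst w; f_equal; apply proof_irrelevance].
  apply functional_extensionality; intro g; apply NNPP; intro Hg; apply Hn; now exists g. }
destruct H as [g Hg]; set (c := Rabs (proj1_sig z g - proj1_sig w g) / 2).
assert (Hc : 0 < c) by (assert (H := Rabs_pos_lt _ (Rminus_eq_contra _ _ Hg)); unfold c; lra).
exists (fun x => proj1_sig z g - c < proj1_sig x g < proj1_sig z g + c),
       (fun x => proj1_sig w g - c < proj1_sig x g < proj1_sig w g + c).
repeat split; try apply open_coord_between; try lra.
intros x [H1 H2]; revert H1 H2 Hc; unfold c, Rabs; destruct Rcase_abs; lra.
Qed.

(** Within [K] and near [z], the coordinates enumerated by [c] control all others, so the boxes of
    radius [1 / (n + 1)] in the first [n + 1] of them form a base at [z]. *)
Lemma pointwise_first_countable {G : Type} (K : (G -> R) -> Prop) :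
  (forall z, K z -> exists c : nat -> G, forall g eps, 0 < eps -> exists l delta, 0 < delta /\
     forall z', K z' -> near (fun _ => True) (map c l) delta z z' -> Rabs (z' g - z g) < eps) ->
  first_countable (pointwise K).
Proof.
intros H [z Kz]; destruct (H z Kz) as [c Hc]; clear H.
exists (fun n z' => forall i, (i <= n)%nat ->
  z (c i) - / INR (S n) < proj1_sig z' (c i) < z (c i) + / INR (S n)).
assert (Hpos : forall n, 0 < / INR (S n)) by (intro; apply Rinv_0_lt_compat, lt_0_INR; lia).
split.
- intro n; split; [|intros i _; cbn [proj1_sig]; specialize (Hpos n); lra].
  (* The radius is frozen so that the induction on [n] changes only the number of constrained
     coordinates. *)
  generalize (/ INR (S n)) as e; intro e.
  induction n as [|n IH].
  + intros w Hw; destruct (open_coord_between K (c 0%nat) _ _ w (Hw 0%nat (le_n _)))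
      as [l [d [Hd Hl]]].
    exists l, d; split; [exact Hd|]; intros z' Hz' i Hi.
    replace i with 0%nat by lia; now apply Hl.
  + intros w Hw.
    destruct (IH w (fun i Hi => Hw i (le_S _ _ Hi))) as [l1 [d1 [Hd1 H1]]].
    destruct (open_coord_between K (c (S n)) _ _ w (Hw (S n) (le_n _))) as [l2 [d2 [Hd2 H2]]].
    exists (l1 ++ l2), (Rmin d1 d2); split; [now apply Rmin_pos|].
    intros z' Hz' i Hi; apply near_app in Hz'; destruct Hz' as [Hz1 Hz2].
    destruct (Nat.eq_dec i (S n)) as [-> | Hne]; [now apply H2 | apply H1; [exact Hz1 | lia]].
- intros U HU Uz; destruct (HU _ Uz) as [l [eps [He Hl]]]; simpl in Hl.
  assert (Hn : exists n, forall z' : {z | K z}, (forall i, (i <= n)%nat ->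
      z (c i) - / INR (S n) < proj1_sig z' (c i) < z (c i) + / INR (S n)) ->
    near (fun _ => True) l eps z (proj1_sig z')).
  { assert (Hmono : forall n m, (n <= m)%nat -> / INR (S m) <= / INR (S n)).
    { intros n m Hnm; apply Rinv_le_contravar; [apply lt_0_INR; lia | apply le_INR; lia]. }
    clear Hl; induction l as [|g l IH]; [exists 0%nat; easy|].
    destruct IH as [n1 H1]; destruct (Hc g eps He) as [lc [d [Hd H2]]].
    destruct (archimed_cor1 d Hd) as [n2 [Hn2 Hn2p]].
    (* Large enough to constrain the remaining coordinates, to make the radius less than [d], and to
       reach every index in [lc]. *)
    set (n := (n1 + n2 + list_max lc)%nat); exists n; intros z' Hz'.
    intros b [<- | Hb] _.
    - apply H2; [apply proj2_sig|]; intros b Hb _.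
      apply in_map_iff in Hb; destruct Hb as [i [<- Hi]].
      assert (Hin : (i <= list_max lc)%nat).
      { pose proof (proj1 (list_max_le lc (list_max lc)) (le_n _)) as HF.
        rewrite Forall_forall in HF; auto. }
      specialize (Hz' i ltac:(lia)).
      assert (/ INR (S n) <= / INR n2).
      { apply Rinv_le_contravar; [apply lt_0_INR; lia | apply le_INR; lia]. }
      apply Rabs_def1; lra.
    - apply H1; auto; intros i Hi; specialize (Hz' i ltac:(lia)).
      specialize (Hmono n1 n ltac:(lia)); lra. }
  destruct Hn as [n Hn]; exists n; intros z' Hz'; apply Hl, Hn, Hz'.
Qed.

(** * Cardinality of first countable compacta *)

Definition bit (P : nat -> Prop) n : R := if excluded_middle_informative (P n) then 1 else 0.

(** Partial sums of the ternary expansion with digits 0 and 1 and weights starting at 1. *)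
Fixpoint ternary (P : nat -> Prop) n : R :=
  match n with O => 0 | S m => ternary P m + bit P m * (/ 3) ^ m end.

Lemma bit_bounds P n : 0 <= bit P n <= 1.
Proof. unfold bit; destruct excluded_middle_informative; lra. Qed.

Lemma pow_third_pos n : 0 < (/ 3) ^ n.
Proof. apply pow_lt; lra. Qed.

Lemma ternary_bounds P n k :
  ternary P n <= ternary P (n + k) /\
  ternary P (n + k) + 3 / 2 * (/ 3) ^ (n + k) <= ternary P n + 3 / 2 * (/ 3) ^ n.
Proof.
induction k as [|k IH]; [rewrite Nat.add_0_r; lra|].
rewrite Nat.add_succ_r; simpl.
pose proof (bit_bounds P (n + k)); pose proof (pow_third_pos (n + k)); nra.
Qed.

(** At the first [n] where two sets differ, the set containing [n] gains [(/ 3) ^ n], while all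
    later digits of the other add up to at most half of that. *)
Lemma subset_real_injection : exists phi : (nat -> Prop) -> R,
  forall P Q, phi P = phi Q -> forall n, P n <-> Q n.
Proof.
assert (H : forall P, exists x, is_lub (fun t => exists n, t = ternary P n) x).
{ intro P; destruct (completeness (fun t => exists n, t = ternary P n)) as [x Hx]; [| |eauto].
  - exists (3 / 2); intros t [n ->]; destruct (ternary_bounds P 0 n) as [_ H]; simpl in H.
    pose proof (pow_third_pos n); lra.
  - exists 0, 0%nat; reflexivity. }
apply choice in H; destruct H as [phi Hphi]; exists phi.
assert (Hlt : forall P Q n, ternary P n = ternary Q n -> P n -> ~ Q n -> phi Q < phi P).
{ intros P Q n Heq HP HQ; pose proof (pow_third_pos n) as Hpos.
  assert (H1 : ternary P n + (/ 3) ^ n <= phi P).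
  { apply (proj1 (Hphi P)); exists (S n); simpl; unfold bit.
    destruct excluded_middle_informative; [lra | easy]. }
  assert (H2 : phi Q <= ternary Q n + / 2 * (/ 3) ^ n).
  { apply (proj2 (Hphi Q)); intros t [m ->].
    destruct (Nat.le_gt_cases m n) as [Hm | Hm].
    - destruct (ternary_bounds Q m (n - m)) as [H _].
      replace (m + (n - m))%nat with n in H by lia; lra.
    - destruct (ternary_bounds Q (S n) (m - S n)) as [_ H].
      replace (S n + (m - S n))%nat with m in H by lia; simpl in H; unfold bit in H.
      pose proof (pow_third_pos m).
      destruct excluded_middle_informative; [easy | lra]. }
  lra. }
intros P Q HPQ.
assert (Hn : forall n, (forall m, (m < n)%nat -> (P m <-> Q m)) /\ ternary P n = ternary Q n).
{ induction n as [|n [IH1 IH2]]; [split; [lia | reflexivity]|].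
  assert (Hn : P n <-> Q n).
  { split; intro H; apply NNPP; intro H';
      [specialize (Hlt P Q n IH2 H H') | specialize (Hlt Q P n (eq_sym IH2) H H')]; lra. }
  split.
  - intros m Hm; destruct (Nat.eq_dec m n) as [-> | Hne]; [exact Hn | apply IH1; lia].
  - simpl; rewrite IH2; unfold bit.
    destruct (excluded_middle_informative (P n)), (excluded_middle_informative (Q n)); tauto. }
intro n; apply (proj1 (Hn (S n))); lia.
Qed.

(* Terms for the points obtained from one point by taking limits of sequences
   ([Lim]) and by choosing a point outside a countable union of basic
   neighbourhoods ([Out]). *)
Inductive tree : Type :=
| Leaf
| Lim (t : nat -> tree)
| Out (n : nat -> nat) (t : nat -> tree).

(* Labels beyond a leaf are the junk value 0. *)
Fixpoint label (t : tree) (l : list nat) (j : nat) : nat :=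
  match t, l with
  | Leaf, _ => 0
  | Lim _, nil => 1
  | Out n _, nil => S (S (n j))
  | Lim t, i :: l => label (t i) l j
  | Out _ t, i :: l => label (t i) l j
  end.

(** The root label 0, 1 or at least 2 tells the constructors apart, and at an [Out] node the
    argument [j] reads off the sequence of numbers one value at a time. *)
Lemma label_injective s t : (forall l j, label s l j = label t l j) -> s = t.
Proof.
revert t; induction s as [|s IH|n s IH]; intros [|t|m t] H;
  try (specialize (H nil 0%nat); simpl in H; discriminate).
- reflexivity.
- f_equal; apply functional_extensionality; intro i; apply IH; intros l j; exact (H (i :: l) j).
- f_equal.
  + apply functional_extensionality; intro j; specialize (H nil j); simpl in H; congruence.
  + apply functional_extensionality; intro i; apply IH; intros l j; exact (H (i :: l) j).
Qed.

Fixpoint list_code (l : list nat) : nat :=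
  match l with nil => 0 | a :: l => S (Cantor.to_nat (a, list_code l)) end.

Lemma list_code_injective l l' : list_code l = list_code l' -> l = l'.
Proof.
revert l'; induction l as [|a l IH]; intros [|b l'] H; try discriminate; [reflexivity|].
apply eq_add_S, Cantor.to_nat_inj in H; injection H as -> H; f_equal; auto.
Qed.

(** A tree is coded by the graph of its labelling, a set of natural numbers. *)
Lemma tree_real_injection : exists f : tree -> R, forall s t, f s = f t -> s = t.
Proof.
destruct subset_real_injection as [phi Hphi].
exists (fun t => phi (fun p => exists l j,
  p = Cantor.to_nat (list_code l, Cantor.to_nat (j, label t l j)))).
intros s t Hst; apply label_injective; intros l j.
specialize (proj1 (Hphi _ _ Hst (Cantor.to_nat (list_code l, Cantor.to_nat (j, label s l j)))));
  intro H.
destruct H as [l' [j' H]]; [now exists l, j|].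
apply Cantor.to_nat_inj in H; apply pair_equal_spec in H; destruct H as [H1 H2].
apply list_code_injective in H1; subst l'; apply Cantor.to_nat_inj in H2.
apply pair_equal_spec in H2; now destruct H2 as [<- H2].
Qed.

(* Arhangel'skii's theorem for first countable compacta: the closure of a point
   under [Lim] and [Out] is sequentially closed, hence closed, and a point
   outside it could be separated from it by finitely many basic neighbourhoods. *)
Lemma first_countable_compact_card {K : Type} (T : topology K) :
  is_topology T -> compact T -> hausdorff T -> first_countable T ->
  exists f : K -> R, forall x y, f x = f y -> x = y.
Proof.
intros [HT1 [HT2 _]] Hc Hh Hfc.
destruct (classic (inhabited K)) as [[k0] | Hempty];
  [|exists (fun _ => 0); intros x; destruct Hempty; now constructor].
apply choice in Hfc; destruct Hfc as [B HB].
set (converges := fun (a : nat -> K) x =>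
  forall U, T U -> U x -> exists N, forall n, (N <= n)%nat -> U (a n)).
(* [epsilon] returns an arbitrary point when the sequence has no limit or no point lies outside the
   neighbourhoods. *)
set (val := fix val (t : tree) : K :=
  match t with
  | Leaf => k0
  | Lim t => epsilon (inhabits k0) (converges (fun i => val (t i)))
  | Out n t => epsilon (inhabits k0) (fun k => forall i, ~ B (val (t i)) (n i) k)
  end).
(* Otherwise a sequence of values converges to [x]; the value of its [Lim] is also a limit, so it is
   [x] by the Hausdorff property. *)
assert (Hcl : forall x, (forall t, val t <> x) ->
  exists W, T W /\ W x /\ forall t, ~ W (val t)).
{ intros x Hx.
  (* The sets [B x i] need not decrease with [i], hence the finite intersections. *)
  assert (HW : forall n, exists W, T W /\ W x /\ forall z, W z -> forall i, (i <= n)%nat -> B x i z).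
  { induction n as [|n [W [H1 [H2 H3]]]].
    - exists (B x 0%nat); repeat split; try apply HB.
      intros z Hz i Hi; now replace i with 0%nat by lia.
    - exists (fun z => W z /\ B x (S n) z); repeat split; auto; [apply HT2; auto; apply HB | apply HB|].
      intros z [Wz Bz] i Hi; destruct (Nat.eq_dec i (S n)) as [-> | Hne]; [exact Bz|].
      apply H3; [exact Wz | lia]. }
  apply NNPP; intro Hn.
  assert (Hseq : forall n, exists t, forall i, (i <= n)%nat -> B x i (val t)).
  { intro n; destruct (HW n) as [W [H1 [H2 H3]]]; apply NNPP; intro Hn'.
    apply Hn; exists W; repeat split; auto; intros t Wt; apply Hn'; exists t; auto. }
  apply choice in Hseq; destruct Hseq as [t Ht].
  assert (Hconv : converges (fun i => val (t i)) x).
  { intros U HU Ux; destruct (proj2 (HB x) U HU Ux) as [N HN]; exists N; auto. }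
  assert (Hconv' : converges (fun i => val (t i)) (val (Lim t))).
  { apply (epsilon_spec (inhabits k0) (converges _)); now exists x. }
  destruct (Hh _ _ (Hx (Lim t))) as [U [V [HU [HV [Ux [Vx HUV]]]]]].
  destruct (Hconv' U HU Ux) as [N1 H1]; destruct (Hconv V HV Vx) as [N2 H2].
  apply (HUV (val (t (N1 + N2)%nat))); split; [apply H1 | apply H2]; lia. }
assert (Hsurj : forall y, exists t, val t = y).
{ intro y; apply NNPP; intro Hy.
  assert (Hsep : forall t, exists n, ~ B (val t) n y).
  { intro t; destruct (Hh (val t) y) as [U [V [HU [HV [Ux [Vy HUV]]]]]].
    - intro; apply Hy; now exists t.
    - destruct (proj2 (HB (val t)) U HU Ux) as [n Hn]; exists n; intro H; apply (HUV y); auto. }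
  (* If [y] is not a value, [K] is covered by open sets that miss all values and basic
     neighbourhoods of values that miss [y]. For a finite subcover, [Out] yields a value that no
     member contains; [y] witnesses that the choice is possible. *)
  set (F := fun W => T W /\ ((forall t, ~ W (val t)) \/ exists t n, W = B (val t) n /\ ~ W y)).
  destruct (Hc F) as [l [Hl1 Hl2]].
  - now intros U [HU _].
  - intro x; destruct (classic (exists t, val t = x)) as [[t <-] | Hx].
    + destruct (Hsep t) as [n Hn]; exists (B (val t) n).
      split; [split; [apply HB | right; eauto] | apply HB].
    + destruct (Hcl x) as [W [H1 [H2 H3]]]; [intros t Ht; apply Hx; now exists t|].
      exists W; split; [split; auto | exact H2].
  - assert (Hseq : exists t n, (forall i : nat, ~ B (val (t i)) (n i) y) /\
      forall W, In W l -> (forall t, ~ W (val t)) \/ exists i, W = B (val (t i)) (n i)).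
    { clear Hl2; induction l as [|W l IH].
      - destruct (Hsep Leaf) as [n Hn]; exists (fun _ => Leaf), (fun _ => n); split; easy.
      - destruct IH as [t [n [H1 H2]]]; [intros; apply Hl1; now right|].
        destruct (Hl1 W (or_introl eq_refl)) as [_ [HW | [s [m [HW Wy]]]]].
        + exists t, n; split; [exact H1|]; intros W' [<- | HW']; auto.
        + exists (fun i => match i with O => s | S i => t i end),
                 (fun i => match i with O => m | S i => n i end); split.
          * intros [|i]; [congruence | apply H1].
          * intros W' [<- | HW']; [right; now exists 0%nat|].
            destruct (H2 W' HW') as [H | [i Hi]]; [now left | right; now exists (S i)]. }
    destruct Hseq as [t [n [H1 H2]]].
    assert (Hout : forall i, ~ B (val (t i)) (n i) (val (Out n t))).
    { apply (epsilon_spec (inhabits k0) (fun k => forall i, ~ B (val (t i)) (n i) k)); now exists y. }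
    destruct (Hl2 (val (Out n t))) as [W [HW Wo]].
    destruct (H2 W HW) as [H | [i ->]]; [exact (H _ Wo) | exact (Hout i Wo)]. }
apply choice in Hsurj; destruct Hsurj as [g Hg].
destruct tree_real_injection as [f Hf]; exists (fun x => f (g x)).
intros x y Hxy; rewrite <- (Hg x), <- (Hg y); f_equal; auto.
Qed.

(** * Compactification of metrizable spaces *)

(* Stone's theorem on sigma-discrete refinements. Write [k] for the pair [(m, n)]
   and put [r = 1 / (m + 1)], [delta = 1 / (n + 1)]. A point [c] belongs to the piece of
   the center [s] when [s] is the first point at distance less than [r] from [c] and
   [d c s <= r - 2 * delta]; distinct pieces are then at distance at least [2 * delta]. *)
Lemma sigma_discrete_functions {X : Type} (d : X -> X -> R) : is_metric d ->
  exists (a : nat -> X -> R) (s : nat -> X -> X),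
    (forall k x, 0 <= a k x <= (/ 4) ^ S k) /\
    (forall k x y, Rabs (a k y - a k x) <= d x y) /\
    (forall k x, 0 < a k x -> exists eps, 0 < eps /\ forall y, d x y < eps -> s k y = s k x) /\
    (forall x eps, 0 < eps -> exists k, 0 < a k x /\
       forall y, 0 < a k y -> s k y = s k x -> d x y < eps).
Proof.
intros [Hd0 [Hdeq [Hsym Htri]]].
destruct (well_order_exists X) as [lt [wf tri]].
set (r := fun k => / INR (S (fst (Cantor.of_nat k)))).
set (delta := fun k => / INR (S (snd (Cantor.of_nat k)))).
assert (Hdelta : forall k, 0 < delta k <= 1).
{ intro k; unfold delta; split; [apply Rinv_0_lt_compat, lt_0_INR; lia|].
  rewrite <- Rinv_1; apply Rinv_le_contravar; [lra|].
  apply (le_INR 1); lia. }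
set (piece := fun k s c => d c s <= r k - 2 * delta k /\ forall t, lt t s -> r k <= d c t).
(* The open [delta k]-neighbourhood of the piece of [s]; by the distance between pieces, these are
   disjoint for distinct [s]. *)
set (shadow := fun k x s => exists c, piece k s c /\ d x c < delta k).
assert (Huniq : forall k x s t, shadow k x s -> shadow k x t -> s = t).
{ assert (Hlt : forall k x s t, shadow k x s -> shadow k x t -> ~ lt s t).
  { intros k x s t [c [[Hc _] Hxc]] [c' [[_ Hc'] Hxc']] Hst.
    specialize (Hc' s Hst); pose proof (Htri c' c s); pose proof (Htri c' x c).
    rewrite (Hsym c' x) in *; lra. }
  intros k x s t Hs Ht; destruct (tri s t) as [H | [H | H]];
    [exact H | destruct (Hlt k x s t Hs Ht H) | destruct (Hlt k x t s Ht Hs H)]. }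
(* [b (k, x)] is the positive part of [delta k] minus the distance from [x] to the union of the
   pieces; as a supremum it is 1-Lipschitz. *)
assert (Hlub : forall p : nat * X, exists b,
  is_lub (fun v => v = 0 \/ exists s c, piece (fst p) s c /\ v = delta (fst p) - d (snd p) c) b).
{ intros [k x]; simpl.
  destruct (completeness (fun v => v = 0 \/ exists s c, piece k s c /\ v = delta k - d x c))
    as [b Hb]; [| |eauto].
  - exists 1; intros v [-> | [s [c [_ ->]]]]; [lra|].
    specialize (Hdelta k); specialize (Hd0 x c); lra.
  - exists 0; now left. }
apply choice in Hlub; destruct Hlub as [b Hb].
set (s := fun k x => epsilon (inhabits x) (shadow k x)).
assert (Hs : forall k x t, shadow k x t -> s k x = t).
{ intros k x t Ht; apply (Huniq k x); [|exact Ht].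
  apply (epsilon_spec (inhabits x) (shadow k x)); now exists t. }
assert (Hpos : forall k x, 0 < b (k, x) -> shadow k x (s k x)).
{ intros k x Hbx; apply NNPP; intro Hn.
  assert (b (k, x) <= 0); [|lra].
  apply (proj2 (Hb (k, x))); intros v [-> | [t [c [Hc ->]]]]; [lra|]; simpl in *.
  apply Rnot_lt_le; intro Hlt; apply Hn.
  assert (Ht : shadow k x t) by (exists c; split; [exact Hc | lra]).
  now rewrite (Hs k x t Ht). }
assert (Hb0 : forall k x, 0 <= b (k, x)) by (intros k x; apply (proj1 (Hb (k, x))); now left).
assert (Hb1 : forall k x, b (k, x) <= 1).
{ intros k x; apply (proj2 (Hb (k, x))); intros v [-> | [t [c [_ ->]]]]; simpl; [lra|].
  specialize (Hdelta k); specialize (Hd0 x c); lra. }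
assert (Hlip : forall k x y, b (k, y) <= b (k, x) + d x y).
{ intros k x y; apply (proj2 (Hb (k, y))); intros v [-> | [t [c [Hc ->]]]]; simpl in *.
  - specialize (Hb0 k x); specialize (Hd0 x y); lra.
  - assert (delta k - d x c <= b (k, x)) by (apply (proj1 (Hb (k, x))); right; eauto).
    specialize (Htri x y c); lra. }
assert (Hw : forall k, 0 < (/ 4) ^ S k <= 1).
{ intro k; split; [apply pow_lt; lra|]; rewrite <- (pow1 (S k)); apply pow_incr; lra. }
(* The weights make the coordinates square summable over [k]. *)
exists (fun k x => (/ 4) ^ S k * b (k, x)), s; split; [|split; [|split]].
- intros k x; specialize (Hw k); specialize (Hb0 k x); specialize (Hb1 k x); nra.
- intros k x y; rewrite <- Rmult_minus_distr_l, Rabs_mult, (Rabs_pos_eq (_ ^ _)) by apply (Rlt_le _ _ (proj1 (Hw k))).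
  assert (Rabs (b (k, y) - b (k, x)) <= d x y).
  { pose proof (Hlip k x y); pose proof (Hlip k y x); rewrite (Hsym y x) in *.
    apply Rabs_le; lra. }
  specialize (Hw k); pose proof (Rabs_pos (b (k, y) - b (k, x))); nra.
- intros k x Hx; assert (Hbx : 0 < b (k, x)) by (specialize (Hw k); nra).
  destruct (Hpos k x Hbx) as [c [Hc Hxc]]; exists (delta k - d x c); split; [lra|].
  intros y Hy; apply Hs; exists c; split; [exact Hc|].
  specialize (Htri y x c); rewrite (Hsym y x) in Htri; lra.
- intros x eps He.
  (* First [r < eps / 2] is fixed, then [t] as the first point within [r] of [x], then [delta] so
     small that [x] belongs to the piece of [t]. Points in the shadow of [t] are then within [2 * r]
     of [x]. *)
  destruct (archimed_cor1 (eps / 2) ltac:(lra)) as [[|m] [Hm Hmp]]; [lia|].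
  assert (Hfirst : exists t, d x t < / INR (S m) /\ forall u, lt u t -> / INR (S m) <= d x u).
  { assert (Hx : d x x < / INR (S m)).
    { rewrite (proj2 (Hdeq x x) eq_refl); apply Rinv_0_lt_compat, lt_0_INR; lia. }
    apply NNPP; intro Hn; revert Hx; generalize x at 2; intro t.
    induction (wf t) as [t _ IH]; intro Ht; apply Hn; exists t; split; [exact Ht|].
    intros u Hu; apply Rnot_lt_le; intro; now apply (IH u). }
  destruct Hfirst as [t [Ht1 Ht2]].
  destruct (archimed_cor1 ((/ INR (S m) - d x t) / 2) ltac:(lra)) as [[|n] [Hn Hnp]]; [lia|].
  set (k := Cantor.to_nat (m, n)).
  assert (Hr : r k = / INR (S m)) by (unfold r, k; now rewrite Cantor.cancel_of_to).
  assert (Hdk : delta k = / INR (S n)) by (unfold delta, k; now rewrite Cantor.cancel_of_to).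
  assert (Hpx : piece k t x) by (unfold piece; rewrite Hr, Hdk; split; [lra | exact Ht2]).
  assert (Hdx : d x x = 0) by now apply Hdeq.
  exists k; split.
  + apply Rmult_lt_0_compat; [apply Hw|].
    apply Rlt_le_trans with (delta k); [apply Hdelta|].
    apply (proj1 (Hb (k, x))); right; exists t, x; simpl; split; [exact Hpx | lra].
  + intros y Hy Hsy.
    assert (Hby : 0 < b (k, y)) by (specialize (Hw k); nra).
    destruct (Hpos k y Hby) as [c [[Hc _] Hyc]].
    assert (Hst : s k x = t).
    { apply Hs; exists x; split; [exact Hpx|]; specialize (Hdelta k); lra. }
    rewrite Hsy, Hst in Hc; pose proof (Htri x t y); pose proof (Htri t c y).
    rewrite (Hsym t c), (Hsym c y) in *; specialize (Hdelta k); lra.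
Qed.

(** * Hedgehog coordinates and the closure of the embedded space *)

Inductive index (X : Type) : Type :=
| Radius (k : nat)
| Angle (k : nat)
| Spike (k : nat) (s : X).
Arguments Radius {X}.
Arguments Angle {X}.
Arguments Spike {X}.

(** All spikes of one hedgehog share a level: a point has at most one of them nonzero, so levels
    still separate its nonzero coordinates. *)
Definition level {X : Type} (g : index X) : nat :=
  match g with Radius k => 3 * k | Angle k => 3 * k + 1 | Spike k _ => 3 * k + 2 end.

(** On the nonzero terms [lev] is injective, so they are dominated by distinct terms of a geometric
    series. *)
Lemma fsum_geometric {G : Type} (f : G -> R) (lev : G -> nat) (l : list G) :
  NoDup l -> (forall g, 0 <= f g <= (/ 2) ^ lev g) ->
  (forall g h, f g <> 0 -> f h <> 0 -> lev g = lev h -> g = h) -> fsum f l <= 2.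
Proof.
intros Hl Hf Hinj.
assert (H : exists L, NoDup L /\ fsum f l <= fsum (pow (/ 2)) L /\
  forall i, In i L -> exists g, In g l /\ f g <> 0 /\ lev g = i).
{ induction Hl as [|a l Ha Hl IH].
  - exists nil; split; [constructor | split; [simpl; lra | easy]].
  - destruct IH as [L [H1 [H2 H3]]].
    destruct (Req_dec (f a) 0) as [Hfa | Hfa].
    + exists L; split; [exact H1 | split; [simpl; lra|]].
      intros i Hi; destruct (H3 i Hi) as [g [Hg Hg']]; exists g; split; [now right | exact Hg'].
    + exists (lev a :: L); split; [|split].
      * constructor; [|exact H1]; intro Hin; destruct (H3 _ Hin) as [g [Hg [Hfg Hlev]]].
        rewrite (Hinj g a Hfg Hfa Hlev) in Hg; exact (Ha Hg).
      * simpl; specialize (Hf a); lra.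
      * intros i [<- | Hi]; [exists a; split; [now left | now split]|].
        destruct (H3 i Hi) as [g [Hg Hg']]; exists g; split; [now right | exact Hg']. }
destruct H as [L [HL [HfL _]]].
assert (Hseq : forall n m, fsum (pow (/ 2)) (seq m n) <= 2 * (/ 2) ^ m).
{ induction n as [|n IH]; intro m; simpl.
  - assert (0 < (/ 2) ^ m) by (apply pow_lt; lra); lra.
  - specialize (IH (S m)); simpl in IH; lra. }
eapply Rle_trans; [exact HfL|]; eapply Rle_trans; [|rewrite <- (Rmult_1_r 2); apply (Hseq (S (list_max L)) 0%nat)].
apply fsum_incl; [intro; apply pow_le; lra | exact HL | apply seq_NoDup |].
intros i Hi; apply in_seq.
pose proof (proj1 (list_max_le L (list_max L)) (le_n _)) as HF; rewrite Forall_forall in HF.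
specialize (HF i Hi); lia.
Qed.

(** Where [a] is positive, [h] is locally constant; where [a] vanishes, the bound on [h] makes the
    product small together with [a]. *)
Lemma lipschitz_mul_locally_constant {X : Type} (d : X -> X -> R) (a h : X -> R) :
  (forall x, 0 <= a x) -> (forall x y, Rabs (a y - a x) <= d x y) -> (forall x, Rabs (h x) <= 1) ->
  (forall x, 0 < a x -> exists eps, 0 < eps /\ forall y, d x y < eps -> h y = h x) ->
  forall x eps, 0 < eps -> exists delta, 0 < delta /\
    forall y, d x y < delta -> Rabs (a y * h y - a x * h x) < eps.
Proof.
intros Ha Hlip Hh Hloc x eps He.
destruct (Rle_lt_or_eq_dec 0 (a x) (Ha x)) as [Hx | Hx].
- destruct (Hloc x Hx) as [e [He' Hc]]; exists (Rmin e eps); split; [now apply Rmin_pos|].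
  intros y Hy; rewrite (Hc y); [|eapply Rlt_le_trans; [exact Hy | apply Rmin_l]].
  rewrite <- Rmult_minus_distr_r, Rabs_mult.
  pose proof (Rmin_r e eps); specialize (Hlip x y); specialize (Hh x).
  pose proof (Rabs_pos (a y - a x)); pose proof (Rabs_pos (h x)); nra.
- exists eps; split; [exact He|]; intros y Hy; specialize (Hlip x y); specialize (Hh y).
  rewrite <- Hx in *; rewrite Rmult_0_l, !Rminus_0_r in *; rewrite Rabs_mult.
  pose proof (Rabs_pos (a y)); pose proof (Rabs_pos (h y)); nra.
Qed.

Definition closure {X G : Type} (f : X -> G -> R) (z : G -> R) : Prop :=
  forall l eps, 0 < eps -> exists x, near (fun _ => True) l eps z (f x).

Lemma closure_compact {X G : Type} (f : X -> G -> R) :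
  (forall g, exists M, forall x, Rabs (f x g) <= M) -> compact (pointwise (closure f)).
Proof.
intro Hbd; apply pointwise_compact.
- intro g; destruct (Hbd g) as [M HM]; exists (M + 1); intros z Hz.
  destruct (Hz (g :: nil) 1 Rlt_0_1) as [x Hx].
  specialize (Hx g (or_introl eq_refl) I); specialize (HM x).
  revert Hx HM; unfold Rabs; repeat destruct Rcase_abs; lra.
- intros z Hz l eps He; destruct (Hz l (eps / 2) ltac:(lra)) as [z' [Hz' Hn]].
  destruct (Hz' l (eps / 2) ltac:(lra)) as [x Hx]; exists x; intros g Hg _.
  specialize (Hn g Hg I); specialize (Hx g Hg I).
  apply Rabs_def2 in Hn, Hx; apply Rabs_def1; lra.
Qed.

Lemma closure_sq_bounded {X G : Type} (f : X -> G -> R) M :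
  (forall x, sq_bounded M (f x)) -> forall z, closure f z -> sq_bounded (2 * M + 2) z.
Proof.
intros HM z Hz l Hl.
(* Approximating within [/ N] costs at most [2 * / N] in each term, hence at most 2 in all. *)
set (N := INR (length l) + 1).
assert (HN : 1 <= N) by (pose proof (pos_INR (length l)); unfold N; lra).
assert (HiN : 0 < / N <= 1).
{ split; [apply Rinv_0_lt_compat; lra|]; rewrite <- Rinv_1; apply Rinv_le_contravar; lra. }
destruct (Hz l (/ N) (proj1 HiN)) as [x Hx]; specialize (HM x l Hl).
assert (H : fsum (fun g => z g * z g) l <=
            2 * fsum (fun g => f x g * f x g) l + INR (length l) * (2 * / N)).
{ clear HM; clearbody N; induction Hl as [|a l Ha Hl IH]; [simpl; lra|].
  assert (IH' : near (fun _ => True) l (/ N) z (f x)) by (intros g Hg; apply Hx; now right).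
  specialize (IH IH').
  change (z a * z a + fsum (fun g => z g * z g) l <=
    2 * (f x a * f x a + fsum (fun g => f x g * f x g) l) + INR (S (length l)) * (2 * / N)).
  rewrite S_INR.
  specialize (Hx a (or_introl eq_refl) I); apply Rabs_def2 in Hx.
  assert (z a * z a <= 2 * (f x a * f x a) + 2 * / N); [|lra].
  assert (Rsqr (f x a - z a) <= / N).
  { apply Rle_trans with (Rsqr (/ N)); [apply Rsqr_le_abs_1; rewrite (Rabs_pos_eq (/ N)) by lra; apply Rabs_le; lra|].
    unfold Rsqr; nra. }
  pose proof (Rle_0_sqr (2 * f x a - z a)); unfold Rsqr in *; lra. }
assert (INR (length l) * / N <= 1).
{ apply Rle_trans with (N * / N); [|right; field; lra].
  apply Rmult_le_compat_r; [lra | unfold N; lra]. }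
lra.
Qed.

(** The factor [a k x] makes the last two kinds of coordinates vanish at the centre of the hedgehog,
    where [s k x] is not controlled. *)
Definition spines {X : Type} (a : nat -> X -> R) (s : nat -> X -> X) (phi : X -> R)
  (x : X) (g : index X) : R :=
  match g with
  | Radius k => a k x
  | Angle k => a k x * phi (s k x)
  | Spike k t => a k x * (if excluded_middle_informative (s k x = t) then 1 else 0)
  end.

(* At every level [k], a limit [z] of points of a hedgehog with spines [t] in the
   directions [phi t] still determines its spine: the closed condition is that a
   nonzero [Spike k t] coordinate forces the other coordinates of this level. *)
Lemma closure_spines {X : Type} (a : nat -> X -> R) (s : nat -> X -> X) (phi : X -> R) :
  (forall k x, 0 <= a k x) -> (forall x, Rabs (phi x) <= 1) ->
  forall z, closure (spines a s phi) z -> forall k t,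
    0 <= z (Spike k t) <= z (Radius k) /\ Rabs (z (Angle k)) <= z (Radius k) /\
    (z (Spike k t) <> 0 -> z (Angle k) = phi t * z (Radius k)).
Proof.
intros Ha Hphi z Hz k t.
assert (Happ : forall eps, 0 < eps -> exists x,
  Rabs (a k x - z (Radius k)) < eps /\ Rabs (a k x * phi (s k x) - z (Angle k)) < eps /\
  Rabs (a k x * (if excluded_middle_informative (s k x = t) then 1 else 0) - z (Spike k t)) < eps).
{ intros eps He; destruct (Hz (Radius k :: Angle k :: Spike k t :: nil) eps He) as [x Hx].
  exists x; split; [|split].
  - exact (Hx (Radius k) (or_introl eq_refl) I).
  - exact (Hx (Angle k) (or_intror (or_introl eq_refl)) I).
  - exact (Hx (Spike k t) (or_intror (or_intror (or_introl eq_refl))) I). }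
assert (Hang : forall x, - a k x <= a k x * phi (s k x) <= a k x).
{ intro x; specialize (Ha k x); specialize (Hphi (s k x)).
  assert (- 1 <= phi (s k x) <= 1) by (revert Hphi; unfold Rabs; destruct Rcase_abs; lra); nra. }
assert (H0 : 0 <= z (Spike k t)).
{ apply Rnot_lt_le; intro Hlt; destruct (Happ (- z (Spike k t)) ltac:(lra)) as [x [_ [_ Hx]]].
  specialize (Ha k x); apply Rabs_def2 in Hx; destruct excluded_middle_informative; lra. }
split; [split; [exact H0|]|split].
- apply Rnot_lt_le; intro Hlt.
  destruct (Happ ((z (Spike k t) - z (Radius k)) / 2) ltac:(lra)) as [x [H1 [_ H3]]].
  specialize (Ha k x); apply Rabs_def2 in H1, H3; destruct excluded_middle_informative; lra.
- apply Rnot_lt_le; intro Hlt.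
  destruct (Happ ((Rabs (z (Angle k)) - z (Radius k)) / 2) ltac:(lra)) as [x [H1 [H2 _]]].
  specialize (Hang x); apply Rabs_def2 in H1, H2; revert Hlt H1 H2; unfold Rabs.
  destruct Rcase_abs; lra.
- intro Hne; apply NNPP; intro Hneq.
  set (c := Rabs (z (Angle k) - phi t * z (Radius k))).
  assert (Hc : 0 < c) by exact (Rabs_pos_lt _ (Rminus_eq_contra _ _ Hneq)).
  (* The first bound forces the approximating point onto the spine [t]; the second contradicts the
     distance [c] of [z] from the direction [phi t]. *)
  destruct (Happ (Rmin (z (Spike k t)) (c / 2))) as [x [H1 [H2 H3]]]; [apply Rmin_pos; lra|].
  pose proof (Rmin_l (z (Spike k t)) (c / 2)); pose proof (Rmin_r (z (Spike k t)) (c / 2)).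
  destruct excluded_middle_informative as [<- | _]; [|apply Rabs_def2 in H3; lra].
  assert (Rabs (phi (s k x) * (a k x - z (Radius k))) <= Rabs (a k x - z (Radius k))).
  { rewrite Rabs_mult; specialize (Hphi (s k x)); pose proof (Rabs_pos (a k x - z (Radius k))); nra. }
  assert (c <= Rabs (a k x * phi (s k x) - z (Angle k)) + Rabs (phi (s k x) * (a k x - z (Radius k)))).
  { unfold c; rewrite (Rabs_minus_sym (a k x * _)).
    eapply Rle_trans; [right | apply Rabs_triang]; f_equal; ring. }
  lra.
Qed.

(* If [z (Radius k) = 0] then [Radius k] controls all spikes of level [k];
   otherwise at most one spike is nonzero in a neighbourhood of [z] given by
   [Radius k] and [Angle k] and one further spike. *)
Lemma closure_spines_first_countable {X : Type} (a : nat -> X -> R) (s : nat -> X -> X)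
  (phi : X -> R) :
  (forall k x, 0 <= a k x) -> (forall x, Rabs (phi x) <= 1) ->
  (forall x y, phi x = phi y -> x = y) ->
  first_countable (pointwise (closure (spines a s phi))).
Proof.
intros Ha Hphi Hinj; apply pointwise_first_countable; intros z Hz.
destruct (Hz nil 1 Rlt_0_1) as [x0 _].
pose proof (closure_spines a s phi Ha Hphi) as Hc.
(* The spine in whose direction [z] points at level [k], unique if the radius is nonzero; an
   arbitrary one if there is none. *)
set (sigma := fun k => epsilon (inhabits x0) (fun t => z (Angle k) = phi t * z (Radius k))).
set (c := fun n => let (k, j) := Cantor.of_nat n in
  match j with 0%nat => Radius k | 1%nat => Angle k | _ => Spike k (sigma k) end).
assert (HcR : forall k, c (Cantor.to_nat (k, 0%nat)) = Radius k)
  by (intro; unfold c; now rewrite Cantor.cancel_of_to).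
assert (HcA : forall k, c (Cantor.to_nat (k, 1%nat)) = Angle k)
  by (intro; unfold c; now rewrite Cantor.cancel_of_to).
assert (HcS : forall k, c (Cantor.to_nat (k, 2%nat)) = Spike k (sigma k))
  by (intro; unfold c; now rewrite Cantor.cancel_of_to).
exists c; intros g eps He.
assert (Hdir : forall n, c n = g -> exists l delta, 0 < delta /\
  forall z', closure (spines a s phi) z' -> near (fun _ => True) (map c l) delta z z' ->
  Rabs (z' g - z g) < eps).
{ intros n <-; exists (n :: nil), eps; split; [exact He|].
  intros z' _ Hn; apply Hn; [now left | exact I]. }
destruct g as [k|k|k t]; [exact (Hdir _ (HcR k)) | exact (Hdir _ (HcA k)) |].
destruct (Hc z Hz k t) as [Hzt [_ Hang]].
destruct (Req_dec (z (Radius k)) 0) as [Hr | Hr].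
- exists (Cantor.to_nat (k, 0%nat) :: nil), eps; split; [exact He|].
  intros z' Hz' Hn; specialize (Hn (Radius k)); cbn [map] in Hn; rewrite HcR in Hn.
  specialize (Hn (or_introl eq_refl) I); apply Rabs_def2 in Hn.
  destruct (Hc z' Hz' k t) as [Hz't _]; apply Rabs_def1; lra.
- destruct (classic (t = sigma k)) as [-> | Ht]; [exact (Hdir _ (HcS k))|].
  assert (Hne : z (Angle k) <> phi t * z (Radius k)).
  { intro Heq; apply Ht.
    assert (Hs : z (Angle k) = phi (sigma k) * z (Radius k)).
    { apply (epsilon_spec (inhabits x0) (fun t => z (Angle k) = phi t * z (Radius k))); now exists t. }
    apply Hinj; apply (Rmult_eq_reg_r (z (Radius k))); [congruence | exact Hr]. }
  assert (Hz0 : z (Spike k t) = 0) by (apply NNPP; intro; now apply Hne, Hang).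
  (* The defect of [z] from the direction [phi t]: if radius and angle move by less than [e / 2], it
     stays nonzero, which keeps the spike [t] at 0. *)
  set (e := Rabs (z (Angle k) - phi t * z (Radius k))).
  assert (He' : 0 < e) by exact (Rabs_pos_lt _ (Rminus_eq_contra _ _ Hne)).
  exists (Cantor.to_nat (k, 0%nat) :: Cantor.to_nat (k, 1%nat) :: nil), (e / 2); split; [lra|].
  intros z' Hz' Hn; cbn [map] in Hn; rewrite HcR, HcA in Hn.
  pose proof (Hn (Radius k) (or_introl eq_refl) I) as H1.
  pose proof (Hn (Angle k) (or_intror (or_introl eq_refl)) I) as H2.
  destruct (Hc z' Hz' k t) as [_ [_ Hang']].
  destruct (Req_dec (z' (Spike k t)) 0) as [-> | Hne']; [rewrite Hz0, Rminus_0_r, Rabs_R0; exact He|].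
  specialize (Hang' Hne').
  assert (Rabs (phi t * (z' (Radius k) - z (Radius k))) <= Rabs (z' (Radius k) - z (Radius k))).
  { rewrite Rabs_mult; specialize (Hphi t); pose proof (Rabs_pos (z' (Radius k) - z (Radius k))); nra. }
  assert (e <= Rabs (z' (Angle k) - z (Angle k)) + Rabs (phi t * (z' (Radius k) - z (Radius k)))).
  { unfold e; rewrite (Rabs_minus_sym (z' (Angle k))).
    eapply Rle_trans; [right | apply Rabs_triang]; f_equal; rewrite Hang'; ring. }
  lra.
Qed.

Lemma spines_sq_bounded {X : Type} (a : nat -> X -> R) (s : nat -> X -> X) (phi : X -> R) :
  (forall k x, 0 <= a k x <= (/ 4) ^ S k) -> (forall x, Rabs (phi x) <= 1) ->
  forall x, sq_bounded 2 (spines a s phi x).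
Proof.
intros Ha Hphi x l Hl; apply (fsum_geometric _ level l Hl).
- intro g; split; [apply Rle_0_sqr|].
  (* The square of the coordinate is at most [(/ 2) ^ (4 * S k)], and [4 * S k] exceeds all three
     levels [3 * k], [3 * k + 1], [3 * k + 2]. *)
  assert (H : exists k, Rabs (spines a s phi x g) <= (/ 4) ^ S k /\ (level g <= 4 * S k)%nat).
  { destruct g as [k|k|k t]; exists k; (split; [|simpl; lia]); simpl spines;
      rewrite ?Rabs_mult, (Rabs_pos_eq (a k x)) by apply Ha; specialize (Ha k x).
    - apply Ha.
    - specialize (Hphi (s k x)); pose proof (Rabs_pos (phi (s k x))); nra.
    - destruct excluded_middle_informative; rewrite ?Rabs_R1, ?Rabs_R0; lra. }
  destruct H as [k [H1 H2]].
  replace (_ * _) with (Rabs (spines a s phi x g) * Rabs (spines a s phi x g))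
    by (rewrite <- Rabs_mult; apply Rabs_pos_eq, Rle_0_sqr).
  apply Rle_trans with ((/ 4) ^ S k * (/ 4) ^ S k).
  + apply Rmult_le_compat; auto; apply Rabs_pos.
  + rewrite <- Rpow_mult_distr; replace (/ 4 * / 4) with ((/ 2) ^ 4) by (simpl; field).
    rewrite <- pow_mult, !pow_inv; apply Rinv_le_contravar; [apply pow_lt; lra|].
    apply Rle_pow; [lra | exact H2].
- intros g h Hg Hh Hgh.
  destruct g as [k|k|k t], h as [m|m|m u]; simpl level in Hgh; try lia; try (f_equal; lia).
  assert (m = k) by lia; subst m; simpl in Hg, Hh.
  destruct (excluded_middle_informative (s k x = t)) in Hg; [|lra].
  destruct (excluded_middle_informative (s k x = u)) in Hh; [congruence | lra].
Qed.

Lemma metrizable_compactification {X : Type} (TX : topology X) (f : X -> R) :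
  metrizable TX -> (forall x y, f x = f y -> x = y) ->
  exists (K : Type) (TK : topology K) (e : X -> K),
    compactification TX TK e /\ first_countable TK /\ uniform_eberlein TK.
Proof.
intros [d [Hd HTX]] Hf.
destruct (sigma_discrete_functions d Hd) as [a [s [Ha [Hlip [Hloc Hbase]]]]].
assert (Ha0 : forall k x, 0 <= a k x) by (intros; apply Ha).
(* An injection into [[-1, 1]], as [atan] is injective and bounded by [PI / 2], which is at most
   2. *)
set (phi := fun x => atan (f x) / 2).
assert (Hphi : forall x, Rabs (phi x) <= 1).
{ intro x; unfold phi; pose proof (atan_bound (f x)); pose proof PI_4; apply Rabs_le; lra. }
assert (Hphi_inj : forall x y, phi x = phi y -> x = y).
{ intros x y H; apply Hf; rewrite <- (tan_atan (f x)), <- (tan_atan (f y)); f_equal.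
  unfold phi in H; lra. }
set (F := spines a s phi).
assert (Hcoord : forall g x eps, 0 < eps -> exists delta, 0 < delta /\
  forall y, d x y < delta -> Rabs (F y g - F x g) < eps).
{ intros [k|k|k t]; unfold F; simpl.
  - intros x eps He; exists eps; split; [exact He|]; intros y Hy; specialize (Hlip k x y); lra.
  - apply (lipschitz_mul_locally_constant d (a k) (fun x => phi (s k x))); auto.
    intros x Hx; destruct (Hloc k x Hx) as [e [He H]]; exists e; split; [exact He|].
    intros y Hy; f_equal; auto.
  - apply (lipschitz_mul_locally_constant d (a k)
      (fun x => if excluded_middle_informative (s k x = t) then 1 else 0)); auto.
    + intro x; destruct excluded_middle_informative; rewrite ?Rabs_R1, ?Rabs_R0; lra.
    + intros x Hx; destruct (Hloc k x Hx) as [e [He H]]; exists e; split; [exact He|].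
      intros y Hy; now rewrite (H y Hy). }
assert (Hspike : forall x eps, 0 < eps -> exists g, 0 < F x g /\ forall y, 0 < F y g -> d x y < eps).
{ intros x eps He; destruct (Hbase x eps He) as [k [Hk H]].
  exists (Spike k (s k x)); unfold F; simpl; split.
  - destruct excluded_middle_informative; [lra | easy].
  - intros y Hy; destruct (excluded_middle_informative (s k y = s k x)) in Hy; [|lra].
    apply H; [lra | assumption]. }
assert (Hcl : forall x, closure F (F x)).
{ intros x l eps He; exists x; intros g _ _; rewrite Rminus_diag, Rabs_R0; exact He. }
assert (Hbd : forall x, sq_bounded 2 (F x)) by now apply spines_sq_bounded.
assert (Hcompact : compact (pointwise (closure F))).
{ apply closure_compact; intro g; exists (sqrt 2); intro x.
  rewrite <- sqrt_Rsqr_abs; apply sqrt_le_1_alt; unfold Rsqr.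
  specialize (Hbd x (g :: nil)); simpl in Hbd; rewrite Rplus_0_r in Hbd.
  apply Hbd; constructor; [easy | constructor]. }
exists {z | closure F z}, (pointwise (closure F)), (fun x => exist _ (F x) (Hcl x)).
split; [split; [|split; [|split; [|split]]]|split].
- apply pointwise_is_topology.
- exact Hcompact.
- apply pointwise_hausdorff.
- split; [|split].
  + intros V HV; apply HTX; intros x Vx; destruct (HV _ Vx) as [l [eps [He H]]]; simpl in H.
    assert (Hdelta : exists delta, 0 < delta /\
      forall y, d x y < delta -> near (fun _ => True) l eps (F x) (F y)).
    { clear H; induction l as [|g l [d1 [Hd1 H1]]]; [exists 1; split; [lra | easy]|].
      destruct (Hcoord g x eps He) as [d2 [Hd2 H2]].
      exists (Rmin d1 d2); split; [now apply Rmin_pos|].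
      intros y Hy b [<- | Hb] _.
      - apply H2; eapply Rlt_le_trans; [exact Hy | apply Rmin_r].
      - apply H1; auto; eapply Rlt_le_trans; [exact Hy | apply Rmin_l]. }
    destruct Hdelta as [delta [Hdelta Hnear]]; exists delta; split; [exact Hdelta|].
    intros y Hy; apply H, Hnear, Hy.
  + intros x y Hxy; apply (f_equal (@proj1_sig _ _)) in Hxy; simpl in Hxy.
    destruct Hd as [Hd0 [Hd1 _]]; apply Hd1; apply NNPP; intro Hne.
    destruct (Hspike x (d x y)) as [g [Hg H]]; [specialize (Hd0 x y); lra|].
    rewrite Hxy in Hg; specialize (H y Hg); lra.
  + intros U HU.
    (* The sets where one coordinate is positive trace a base on [X]; the witness is the union of
       those whose trace lies in [U]. *)
    exists (fun z => exists g, (forall y, 0 < F y g -> U y) /\ 0 < proj1_sig z g); split.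
    * intros z [g [Hg Hz]]; exists (g :: nil), (proj1_sig z g); split; [exact Hz|].
      intros z' Hz'; specialize (Hz' g (or_introl eq_refl) I).
      exists g; split; [exact Hg|]; apply Rabs_def2 in Hz'; lra.
    * intro x; split; [|intros [g [Hg Hx]]; now apply Hg].
      intro Ux; destruct (proj1 (HTX U) HU x Ux) as [eps [He H]].
      destruct (Hspike x eps He) as [g [Hg Hgd]]; exists g; split; auto.
- intros V HV [z Vz]; destruct (HV z Vz) as [l [eps [He H]]].
  destruct (proj2_sig z l eps He) as [x Hx]; exists x; now apply H.
- now apply closure_spines_first_countable.
- apply bounded_uniform_eberlein with (M := 2 * 2 + 2); [|exact Hcompact].
  now apply closure_sq_bounded.
Qed.

Theorem theorem2 (X : Type) (TX : topology X) (HT : is_topology TX)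
  (Hm : metrizable TX) :
  (exists (K : Type) (TK : topology K) (e : X -> K),
      compactification TX TK e /\ first_countable TK /\ uniform_eberlein TK)
  <-> (exists f : X -> R, forall x y, f x = f y -> x = y).
Proof.
split.
- intros [K [TK [e [[HTK [Hc [Hh [[_ [He _]] _]]]] [Hfc _]]]]].
  destruct (first_countable_compact_card TK HTK Hc Hh Hfc) as [f Hf].
  exists (fun x => f (e x)); auto.
- intros [f Hf]; now apply metrizable_compactification with (f := f).
Qed.
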